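(* Let $m\ge 1$ be a natural number and $n=2m+4$. Let $F=\mathbb{Z}^{2m+1}$ with basis $\{g_1,\ldots,g_{2m+1}\}$, let $G=\mathbb{Z}^3$, and let $\mathcal{A}=\operatorname{Sym}_{\mathbb{Z}}(\bigwedge^2F\oplus F\otimes G)\cong\mathbb{Z}[c_{ij},u_{ki}]$, where $1\le i<j\le 2m+1$ for the $c_{ij}$ and $1\le k\le3$, $1\le i\le 2m+1$ for the $u_{ki}$. Set $$C=\sum_{1\le i<j\le 2m+1}c_{ij}\,g_i\wedge g_j\quad\text{and}\quad u_k=\sum_{i=1}^{2m+1}u_{ki}g_i\ \text{ for }1\le k\le 3.$$ The ideal $$\mathcal{I}_n=(C^{m-1}\wedge u_1\wedge u_2\wedge u_3,\ C^m\wedge u_1,\ C^m\wedge u_2,\ C^m\wedge u_3)$$ of $\mathcal{A}$ is a grade $3$ almost complete intersection of type $2m+1=n-3$.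
   Context: Let $A=(c_{ij})$ be the generic $(2m+1)\times(2m+1)$ skew symmetric matrix ($c_{ji}=-c_{ij}$, $c_{ii}=0$). $C^j$ denotes the $j$-th (divided) exterior power of $C$ in $\bigwedge^{2j}F\otimes\mathcal{A}$, that is, $$C^j=\sum_{1\le i_1<\cdots<i_{2j}\le 2m+1}\operatorname{Pf}_{i_1\ldots i_{2j}}(A)\; g_{i_1}\wedge\cdots\wedge g_{i_{2j}},\qquad C^0=1,$$ where $\operatorname{Pf}_{i_1\ldots i_{2j}}(A)$ is the Pfaffian of the submatrix of $A$ on the rows and columns $i_1,\dots,i_{2j}$. The listed generators are elements of $\bigwedge^{2m+1}F\otimes\mathcal{A}\cong\mathcal{A}$, identified with elements of $\mathcal{A}$ via the basis element $g_1\wedge\cdots\wedge g_{2m+1}$. The ring $\mathcal{A}$ is bigraded by $|c_{ij}|=(1,0)$, $|u_{ki}|=(0,1)$. A grade $3$ almost complete intersection ideal is a perfect ideal of grade $3$ minimally generated by four elements; its type is the rank of the third free module in the minimal (graded) free resolution of the quotient ring by the ideal. *)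

(* Defs.v *)
From HB Require Import structures.
From mathcomp Require Import all_boot all_algebra.
From mathcomp Require Import generic_quotient ring_quotient.
From mathcomp Require Import boolp.
From mathcomp Require Import perm mpoly.

Set Implicit Arguments.
Unset Strict Implicit.
Unset Printing Implicit Defensive.

Import GRing.Theory.
Local Open Scope ring_scope.

(* ---------------------------------------------------------------------- *)
(* Ideals and quotient modules                                            *)
(* ---------------------------------------------------------------------- *)

(* Ideals of [R] are the submodules of the regular module [R^o].  Membership
   is made boolean by classical logic, so that the quotients of
   [ring_quotient] apply. *)
Definition ideal_span (R : comNzRingType) (s : seq R) : {pred R^o} :=
  fun x => `[< exists a : 'I_(size s) -> R, x = \sum_(i < size s) a i * s`_i >].

Lemma ideal_span_submod (R : comNzRingType) (s : seq R) :
  submod_closed (ideal_span s).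
Proof.
split; first by apply/asboolP; exists (fun=> 0); rewrite big1 // => i _; rewrite mul0r.
move=> c x y /asboolP[a ->] /asboolP[b ->]; apply/asboolP.
exists (fun i => c * a i + b i).
rewrite /GRing.scale /= mulr_sumr -big_split /=.
by apply: eq_bigr => i _; rewrite mulrDl mulrA.
Qed.

HB.instance Definition _ (R : comNzRingType) (s : seq R) :=
  GRing.isSubmodClosed.Build R R^o (ideal_span s) (ideal_span_submod s).

(* [submodClosed] does not inherit from [zmodClosed], which [Quotient.quot]
   requires; this copy of the predicate carries that structure. *)
Definition zmod_of (R : comNzRingType) (V : lmodType R) (W : submodClosed V) :
  {pred V} := fun x => x \in W.

HB.instance Definition _ (R : comNzRingType) (V : lmodType R)
    (W : submodClosed V) :=
  GRing.isZmodClosed.Build V (zmod_of W) (GRing.submod_closedB (submodClosedP W)).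

Definition quot_module (R : comNzRingType) (V : lmodType R)
  (W : submodClosed V) : Type := Quotient.quot (zmod_of W).

Section QuotModule.
Variables (R : comNzRingType) (V : lmodType R) (W : submodClosed V).

HB.instance Definition _ := GRing.Zmodule.on (quot_module W).

Definition quot_pi (x : V) : quot_module W := (\pi_(Quotient.quot (zmod_of W)) x)%qT.

Definition quot_scale (a : R) (x : quot_module W) : quot_module W :=
  quot_pi (a *: repr (x : Quotient.quot (zmod_of W))).

Lemma quot_pi_eq x y : (quot_pi x == quot_pi y) = (x - y \in W).
Proof. by rewrite /quot_pi -Quotient.idealrBE. Qed.

Lemma quot_pi_surj (x : quot_module W) : exists v, quot_pi v = x.
Proof. by exists (repr (x : Quotient.quot (zmod_of W))); rewrite /quot_pi reprK. Qed.

Lemma quot_piB : {morph quot_pi : x y / x - y}.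
Proof. by move=> x y; rewrite /quot_pi raddfB. Qed.

Lemma quot_piD : {morph quot_pi : x y / x + y}.
Proof. by move=> x y; rewrite /quot_pi raddfD. Qed.

Lemma quot_piZ a x : quot_pi (a *: x) = quot_scale a (quot_pi x).
Proof.
apply/eqP; rewrite /quot_scale quot_pi_eq -scalerBr rpredZ //.
by rewrite -quot_pi_eq /quot_pi reprK.
Qed.

Lemma quot_scaleA a b v : quot_scale a (quot_scale b v) = quot_scale (a * b) v.
Proof. by case: (quot_pi_surj v) => x <-; rewrite -!quot_piZ scalerA. Qed.

Lemma quot_scale1 : left_id 1 quot_scale.
Proof. by move=> v; case: (quot_pi_surj v) => x <-; rewrite -quot_piZ scale1r. Qed.

Lemma quot_scaleDr : right_distributive quot_scale +%R.
Proof.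
move=> a u v; case: (quot_pi_surj u) (quot_pi_surj v) => x <- [y <-].
by rewrite -quot_piD -!quot_piZ scalerDr quot_piD.
Qed.

Lemma quot_scaleDl v : {morph quot_scale^~ v : a b / a + b}.
Proof.
by move=> a b; case: (quot_pi_surj v) => x <-; rewrite -!quot_piZ scalerDl quot_piD.
Qed.

HB.instance Definition _ := GRing.Zmodule_isLmodule.Build R (quot_module W)
  quot_scaleA quot_scale1 quot_scaleDr quot_scaleDl.

HB.instance Definition _ :=
  GRing.isZmodMorphism.Build V (quot_module W) quot_pi quot_piB.
HB.instance Definition _ :=
  GRing.isScalable.Build R V (quot_module W) *:%R quot_pi quot_piZ.

End QuotModule.

(* ---------------------------------------------------------------------- *)
(* Grade, projective dimension, perfection                                *)
(* ---------------------------------------------------------------------- *)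

Definition regular_sequence (R : comNzRingType) (s : seq R) : Prop :=
  1 \notin ideal_span s /\
  forall i, (i < size s)%N ->
    forall x, s`_i * x \in ideal_span (take i s) -> x \in ideal_span (take i s).

(* The grade is the maximal length of a regular sequence in the ideal; the
   improper ideal, whose grade is infinite by convention, never occurs. *)
Definition has_grade (R : comNzRingType) (I : {pred R}) (g : nat) : Prop :=
  (exists s : seq R,
     [/\ size s = g, {subset s <= I} & regular_sequence s]) /\
  (forall s : seq R,
     {subset s <= I} -> regular_sequence s -> (size s <= g)%N).

Definition projective (R : comNzRingType) (P : lmodType R) : Prop :=
  forall (M N : lmodType R) (f : {linear M -> N}) (g : {linear P -> N}),
    (forall y, exists x, f x = y) ->
    exists h : {linear P -> M}, forall x, f (h x) = g x.

(* Exactness of  ... -> P 2 -> P 1 -> P 0 -> M -> 0. *)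
Definition is_resolution (R : comNzRingType) (M : lmodType R)
    (P : nat -> lmodType R) (d : forall i, {linear P i.+1 -> P i})
    (aug : {linear P 0%N -> M}) : Prop :=
  [/\ forall y, exists x, aug x = y,
      forall x, aug x = 0 <-> exists y, d 0%N y = x
    & forall i x, d i x = 0 <-> exists y, d i.+1 y = x].

Definition has_projective_resolution (R : comNzRingType) (M : lmodType R)
    (n : nat) : Prop :=
  exists (P : nat -> lmodType R) (d : forall i, {linear P i.+1 -> P i})
         (aug : {linear P 0%N -> M}),
  [/\ is_resolution d aug,
      forall i, projective (P i)
    & forall i, (n < i)%N -> forall x : P i, x = 0].

Definition has_projective_dimension (R : comNzRingType) (M : lmodType R)
    (n : nat) : Prop :=
  has_projective_resolution M n /\
  (forall k, has_projective_resolution M k -> (n <= k)%N).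

Definition perfect_of_grade (R : comNzRingType) (I : submodClosed R^o)
    (g : nat) : Prop :=
  has_grade I g /\ has_projective_dimension (quot_module I) g.

Definition minimally_generated_by (R : comNzRingType) (I : {pred R})
    (k : nat) : Prop :=
  (exists s : seq R, size s = k /\ I =i ideal_span s) /\
  (forall s : seq R, I =i ideal_span s -> (k <= size s)%N).

Definition grade3_almost_complete_intersection (R : comNzRingType)
    (I : submodClosed R^o) : Prop :=
  perfect_of_grade I 3 /\ minimally_generated_by I 4.

(* ---------------------------------------------------------------------- *)
(* Pfaffians                                                              *)
(* ---------------------------------------------------------------------- *)

(* The permutations s with s 0 < s 1, s 2 < s 3, ... and s 0 < s 2 < s 4 < ...
   represent each perfect matching of 'I_n once; [ordS i] is i + 1 for even i,
   n being even. *)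
Definition matching_perm (n : nat) (s : 'S_n) : bool :=
  [forall i : 'I_n, ~~ odd i ==> (s i < s (ordS i))%N] &&
  [forall i : 'I_n, forall j : 'I_n,
     [&& ~~ odd i, ~~ odd j & (i < j)%N] ==> (s i < s j)%N].

Definition pfaffian (R : comNzRingType) (n : nat) (A : 'M[R]_n) : R :=
  if odd n then 0 else
  \sum_(s : 'S_n | matching_perm s)
    (-1) ^+ s * \prod_(i < n | ~~ odd i) A (s i) (s (ordS i)).

(* [enum_val] lists the elements of S in increasing order. *)
Definition Pf (R : comNzRingType) (N : nat) (A : 'M[R]_N) (S : {set 'I_N}) : R :=
  pfaffian (\matrix_(i < #|S|, j < #|S|) A (enum_val i) (enum_val j)).

(* ---------------------------------------------------------------------- *)
(* The exterior algebra of a free module                                  *)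
(* ---------------------------------------------------------------------- *)

(* [x S] is the coordinate of x on g_(i_1) /\ ... /\ g_(i_k),
   S = {i_1 < ... < i_k}. *)
Definition ext (R : comNzRingType) (N : nat) : Type := {ffun {set 'I_N} -> R^o}.

HB.instance Definition _ (R : comNzRingType) (N : nat) :=
  GRing.Lmodule.on (ext R N).

Definition ext_basis (R : comNzRingType) (N : nat) (S : {set 'I_N}) : ext R N :=
  [ffun T => (T == S)%:R].

(* The number of transpositions needed to sort the concatenation of the
   increasing enumerations of S and T. *)
Definition inversions (N : nat) (S T : {set 'I_N}) : nat :=
  #|[set p : 'I_N * 'I_N | [&& p.1 \in S, p.2 \in T & (p.2 < p.1)%N]]|.

Definition wedge (R : comNzRingType) (N : nat) (x y : ext R N) : ext R N :=
  [ffun U : {set 'I_N} => \sum_(S : {set 'I_N} | S \subset U)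
     (-1) ^+ inversions S (U :\: S) * (x S * y (U :\: S))].

Definition ext_vec (R : comNzRingType) (N : nat) (u : 'I_N -> R) : ext R N :=
  \sum_(i < N) u i *: ext_basis R [set i].

(* For skew symmetric A, the j-th divided power of the 2-form
   \sum_(a < b) A a b g_a /\ g_b. *)
Definition ext_divpow (R : comNzRingType) (N : nat) (A : 'M[R]_N) (j : nat) :
    ext R N :=
  \sum_(S : {set 'I_N} | #|S| == (2 * j)%N) Pf A S *: ext_basis R S.

Definition ext_top (R : comNzRingType) (N : nat) (x : ext R N) : R :=
  x [set: 'I_N].

(* ---------------------------------------------------------------------- *)
(* The ring Z[c_ij, u_ki] and its ideal                                   *)
(* ---------------------------------------------------------------------- *)

(* [inl (i, j)], i < j, indexes c_ij and [inr (k, i)] indexes u_ki. *)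
Definition vars (m : nat) : finType :=
  ({p : 'I_(2 * m + 1) * 'I_(2 * m + 1) | (p.1 < p.2)%N}
   + 'I_3 * 'I_(2 * m + 1))%type.

Definition polyA (m : nat) : comNzRingType := {mpoly int[#|vars m|]}.

Definition var (m : nat) (v : vars m) : polyA m := 'X_(enum_rank v).

Definition generic_skew (m : nat) : 'M[polyA m]_(2 * m + 1) :=
  \matrix_(i, j)
    match insub (i, j), insub (j, i) with
    | Some p, _ => var (inl p)
    | _, Some p => - var (inl p)
    | _, _ => 0
    end.

Definition Cpow (m j : nat) : ext (polyA m) (2 * m + 1) :=
  ext_divpow (generic_skew m) j.

Definition u_ (m : nat) (k : 'I_3) : ext (polyA m) (2 * m + 1) :=
  ext_vec (fun i => var (inr (k, i))).

Definition k1 : 'I_3 := @Ordinal 3 0 isT.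
Definition k2 : 'I_3 := @Ordinal 3 1 isT.
Definition k3 : 'I_3 := @Ordinal 3 2 isT.

(* m - 1 is the truncated subtraction of nat; only m >= 1 is meaningful. *)
Definition ideal_gens (m : nat) : seq (polyA m) :=
  [:: ext_top (wedge (wedge (wedge (Cpow m (m - 1)) (u_ m k1)) (u_ m k2)) (u_ m k3));
      ext_top (wedge (Cpow m m) (u_ m k1));
      ext_top (wedge (Cpow m m) (u_ m k2));
      ext_top (wedge (Cpow m m) (u_ m k3))].

Definition ideal_I (m : nat) : submodClosed (polyA m)^o :=
  ideal_span (ideal_gens m).

(* ---------------------------------------------------------------------- *)
(* Minimal bigraded free resolutions of quotients of the ring, and type   *)
(* ---------------------------------------------------------------------- *)

Definition bideg (m : nat) (mm : 'X_{1..#|vars m|}) : int * int :=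
  (\sum_(v : vars m) (if v is inl _ then (mm (enum_rank v))%:Z else 0),
   \sum_(v : vars m) (if v is inr _ then (mm (enum_rank v))%:Z else 0)).

Definition bihomogeneous (m : nat) (d : int * int) (p : polyA m) : bool :=
  all (fun mm => bideg mm == d) (msupp p).

(* Free modules are row vectors on which matrices act on the right.  [deg i]
   lists the bidegrees of the basis of the i-th module; all maps have degree
   0.  Minimality is that every differential has image in A_+ F, where
   A_+ is the irrelevant ideal, generated by all the variables. *)
Definition is_minimal_graded_resolution (m : nat) (I : submodClosed (polyA m)^o)
    (r : nat -> nat) (deg : forall i, 'I_(r i) -> int * int)
    (D : forall i, 'M[polyA m]_(r i.+1, r i))
    (aug : {linear 'rV[polyA m]_(r 0%N) -> quot_module I}) : Prop :=
  [/\ @is_resolution (polyA m) (quot_module I)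
        (fun i => 'rV[polyA m]_(r i) : lmodType (polyA m))
        (fun i => mulmxr (D i)) aug,
      forall k, exists2 x : (polyA m)^o,
        bihomogeneous (deg 0%N k) x & aug (delta_mx 0 k) = quot_pi I x,
      forall i j k, bihomogeneous (deg i.+1 j - deg i k) (D i j k)
    & forall i j k, (D i j k)@_0%MM = 0].

Definition has_type (m : nat) (I : submodClosed (polyA m)^o) (t : nat) : Prop :=
  exists (r : nat -> nat) (deg : forall i, 'I_(r i) -> int * int)
         (D : forall i, 'M[polyA m]_(r i.+1, r i))
         (aug : {linear 'rV[polyA m]_(r 0%N) -> quot_module I}),
  is_minimal_graded_resolution deg D aug /\ r 3 = t.

(* Main.v *)
From HB Require Import structures.
Require Import Defs.
From mathcomp Require Import all_boot all_algebra.
From mathcomp Require Import boolp perm mpoly.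
From mathcomp Require Import zify ring.

Set Implicit Arguments.
Unset Strict Implicit.
Unset Printing Implicit Defensive.

Import GRing.Theory.
Local Open Scope ring_scope.

(** Write N = 2m + 1, let A be the generic skew matrix, U the 3 x N matrix of the
    u_ki, and p the vector of the signed Pfaffians of A of order 2m, so that
    p_i is the top coefficient of C^m /\ g_i.  The generators of the ideal I are
    a_k = C^m /\ u_k, the entries of U p, and a_0 = C^(m-1) /\ u_1 /\ u_2 /\ u_3.
    With T(x, y, z) the top coefficient of C^(m-1) /\ x /\ y /\ z, the quotient
    by I has the free resolution
<<
         [A | U^T]             [p Y; 0 Z]              [a_0; a]
   0 -> R^N  --->  R^(N+3)  --->  R^(1+3)  --->  R
>>
    (row vectors, matrices acting on the right), where the columns of Y are the
    vectors T(g_i, u_k, u_l) and Z is the matrix of the cross product with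
    a = (a_1, a_2, a_3).  Everything else is deduced from this complex.

    The identities of the complex.  The divided powers of C satisfy
    i_l(C^(k+1)) = C^k /\ (A g_l), where i_l is contraction with the l-th basis
    vector (rcontract_divpow_ge; this amounts to the expansion of a Pfaffian
    along any row, and follows by induction from the expansion along the first
    row).  Contracting forms of degree N + 1, which vanish, gives A p = 0, the
    formula T(A g_l, x, w) = x_l (w.p) - w_l (x.p) (pf_tri_row), and a four-term
    relation (pf_tri_plucker).  These show that the matrices above form a
    complex, and also that multiplication by each of a_1, a_2, a_3 is homotopic
    to zero on it, by explicit homotopies (res_htpy1, res_htpy2, res_htpy3).

    The sequence a_1, a_2, a_3 is regular.  For suitable weights of the
    variables, the initial form of a_k is plus or minus one monomial: a variable
    u_ki times the nested matching of the remaining indices, whose edges c_ab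
    all have the same sum a + b.  For i = 0, m, 2m (with indices counted from 0)
    these sums are 2m + 1, 2m, 2m - 1, so the three monomials are pairwise
    coprime, and polynomials with coprime initial monomials form a regular
    sequence (initial_ideal_step).

    Exactness and grade.  If every element of a regular sequence s acts on a
    complex by zero up to homotopy, then the complex is exact in the first
    positions, one for each element of s (complex_exact_mod).  Applied to the
    complex above read from the left and to a_1, a_2, a_3, this proves that it
    is a resolution.  Applied to its dual and a regular sequence of length 4 in
    I, it would make the map dual to [A | U^T] surjective, which is impossible
    because all entries lie in the irrelevant ideal; hence the grade is 3.

    The same minimality of the resolution gives the remaining bounds: a shorter
    projective resolution would, by comparison, express the identity of R^N
    through [A | U^T] (resolution_length_ge), and a relation with a nonzero
    constant term among the a_i would be needed to generate I by fewer than
    four elements (generators_size_ge).  The last free module has rank N, which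
    is the type. *)

(** * Expansion of a Pfaffian along its first row *)

(** Permutations with a prescribed value at [i] are parametrized by
    permutations of one index less, which allows reindexing sums over them. *)
Lemma lift_perm_onto n (i j : 'I_n.+1) :
  {on [pred s : 'S_n.+1 | s i == j], bijective (lift_perm i j)}.
Proof.
have injL : injective (lift_perm i j).
  move=> s t /permP st; apply/permP => k; apply: (@lift_inj _ j).
  by rewrite -!(lift_perm_lift i) st.
exists (fun s => odflt 1%g [pick t | lift_perm i j t == s]) => [t _ | s /eqP sij].
  by case: pickP => [t' /eqP/injL // | /(_ t)]; rewrite eqxx.
case: pickP => [t' /eqP // | no_t] /=.
pose f k := odflt k (unlift j (s (lift i k))).
have fE k : lift j (f k) = s (lift i k).
  rewrite /f; have : j != s (lift i k) by rewrite -sij (inj_eq perm_inj) neq_lift.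
  by case/unlift_some => ? ? ->.
have injf : injective f.
  by move=> k l /(congr1 (lift j)); rewrite !fE => /perm_inj/lift_inj.
have /negP[] := no_t (perm injf); apply/eqP/permP => k.
by case: (unliftP i k) => [k'|] ->; rewrite ?lift_perm_id ?lift_perm_lift ?permE ?fE.
Qed.

(** The increasing enumeration of the indices other than [0] and [b + 1]. *)
Definition lift2 n (b : 'I_n.+1) (i : 'I_n) : 'I_n.+2 := lift ord0 (lift b i).

(** The permutation listing first the edge {0, b + 1}, then the edges of the
    matching [s] of the other indices. *)
Definition pair_perm n (b : 'I_n.+1) (s : 'S_n) : 'S_n.+2 :=
  lift_perm ord0 ord0 (lift_perm ord0 b s).

Lemma lift2_mono n (b : 'I_n.+1) : {mono lift2 b : i j / (i < j)%N}.
Proof. by move=> i j /=; rewrite /bump !leq0n /=; lia. Qed.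

Lemma odd_lift2 n (i : 'I_n) : odd (lift2 ord0 i) = odd i.
Proof. by rewrite /= /bump /= negbK. Qed.

Lemma pair_perm0 n (b : 'I_n.+1) s : pair_perm b s ord0 = ord0.
Proof. exact: lift_perm_id. Qed.

Lemma pair_perm1 n (b : 'I_n.+1) s : pair_perm b s (lift ord0 ord0) = lift ord0 b.
Proof. by rewrite lift_perm_lift lift_perm_id. Qed.

Lemma pair_perm2 n (b : 'I_n.+1) s i : pair_perm b s (lift2 ord0 i) = lift2 b (s i).
Proof. by rewrite !lift_perm_lift. Qed.

Lemma ord2P n (i : 'I_n.+2) :
  [\/ i = ord0, i = lift ord0 ord0 | exists j, i = lift2 ord0 j].
Proof.
case: (unliftP ord0 i) => [k ->|->]; last by constructor 1.
by case: (unliftP ord0 k) => [j ->|->]; [constructor 3; exists j | constructor 2].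
Qed.

Lemma ordS_lift2 n (i : 'I_n) : ~~ odd n -> ~~ odd i ->
  ordS (lift2 ord0 i) = lift2 ord0 (ordS i).
Proof.
move=> on oi; have lt_i := ltn_ord i; apply: val_inj; rewrite /= /bump !leq0n /=.
by rewrite !modn_small; lia.
Qed.

Lemma ordS_ord0 n : ordS (ord0 : 'I_n.+2) = lift ord0 ord0.
Proof. exact: val_inj. Qed.

(** The edges of a matching are listed with increasing first points and each
    first point is below the second one, so the least index comes first. *)
Lemma matching_perm_ord0 n (s : 'S_n.+2) : ~~ odd n -> matching_perm s -> s ord0 = ord0.
Proof.
move=> on /andP[/forallP up /forallP first].
have [i si] : exists i, s i = ord0 by exists (s^-1%g ord0); rewrite permKV.
case: (boolP (odd i)) => oi; last first.
  have /forallP/(_ i)/implyP := first ord0; rewrite /= oi si /=.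
  case: posnP => [i0 _|_ /(_ isT)]; last by rewrite ltn0.
  by rewrite -[RHS]si (_ : i = ord0) //; apply: val_inj.
have lt_i := ltn_ord i; have i1 : (i.-1 < n.+2)%N by lia.
have /implyP := up (Ordinal i1); have -> : ordS (Ordinal i1) = i.
  by apply: val_inj; rewrite /= prednK ?modn_small //; lia.
by rewrite si ltn0 /= => /(_ ltac:(lia)).
Qed.

Lemma matching_pair_perm n (b : 'I_n.+1) (s : 'S_n) : ~~ odd n ->
  matching_perm (pair_perm b s) = matching_perm s.
Proof.
move=> on; rewrite /matching_perm; congr (_ && _); apply/forallP/forallP => H i.
- apply/implyP => oi; have /implyP := H (lift2 ord0 i).
  rewrite ordS_lift2 // !pair_perm2 lift2_mono; apply.
  by rewrite odd_lift2.
- apply/implyP; case: (ord2P i) => [->|->|[j ->]] //.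
    by rewrite ordS_ord0 pair_perm0 pair_perm1.
  by rewrite odd_lift2 => oj; rewrite ordS_lift2 // !pair_perm2 lift2_mono; apply: (implyP (H j)).
- apply/forallP => j; apply/implyP => /and3P[oi oj ij].
  have /forallP/(_ (lift2 ord0 j))/implyP := H (lift2 ord0 i).
  rewrite !pair_perm2 !lift2_mono; apply.
  by rewrite !odd_lift2 oi oj.
apply/forallP => j; apply/implyP.
case: (ord2P i) => [->|->|[i' ->]] //; case: (ord2P j) => [->|->|[j' ->]];
  rewrite ?pair_perm0 ?pair_perm2 ?lift2_mono ?odd_lift2 //= ?andbF // => ij.
by have /forallP/(_ j')/implyP := H i'; apply.
Qed.

(** The matchings are sorted by the partner [b + 1] of [0].  The sign [(-1) ^+ b]
    is the parity of moving [b + 1] to the second place. *)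
Lemma pfaffian_row0 (R : comNzRingType) n (A : 'M[R]_n.+2) :
  pfaffian A = \sum_(b < n.+1) (-1) ^+ b * A ord0 (lift ord0 b)
                 * pfaffian (\matrix_(i, j) A (lift2 b i) (lift2 b j)).
Proof.
rewrite /pfaffian /= negbK; case: ifP => [_|/negbT on].
  by rewrite big1 // => b _; rewrite mulr0.
rewrite (eq_bigl (fun s : 'S_n.+2 => (s ord0 == ord0) && matching_perm s)); last first.
  move=> s /=; case m_s: (matching_perm s); rewrite ?andbF // andbT.
  by apply/esym/eqP/matching_perm_ord0.
rewrite (reindex (lift_perm ord0 ord0)) /=; last first.
  apply: subon_bij (lift_perm_onto ord0 ord0) => s.
  by rewrite !inE => /andP[].
rewrite (partition_big (fun s : 'S_n.+1 => s ord0) predT) //=.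
apply: eq_bigr => b _; rewrite big_distrr /=.
rewrite (reindex (lift_perm ord0 b)) /=; last first.
  apply: subon_bij (lift_perm_onto ord0 b) => s.
  by rewrite !inE => /andP[].
apply: eq_big => [s | s _].
  by rewrite !lift_perm_id !eqxx andbT -(matching_pair_perm b).
rewrite !odd_lift_perm /= signr_addb signr_odd -!mulrA; congr (_ * _).
rewrite mulrCA; congr (_ * _).
rewrite big_mkcond /= !big_ord_recl /= mul1r; congr (_ * _).
  by rewrite ordS_ord0 -/(pair_perm b s) pair_perm0 pair_perm1.
rewrite [RHS]big_mkcond /=; apply: eq_bigr => i _.
rewrite /bump /= negbK; case: ifP => //= oi.
rewrite !mxE -/(pair_perm b s) -[lift ord0 (lift ord0 i)]/(lift2 ord0 i).
by rewrite ordS_lift2 // !pair_perm2.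
Qed.

(** * Pfaffians of principal submatrices *)

(** The number of transpositions that move [g_i] from the last place of the
    sorted product over [S] to its own, that is, the sign exponent of right
    multiplication by [g_i]. *)
Definition above N (S : {set 'I_N}) (i : 'I_N) : nat := #|[set j in S | (i < j)%N]|.

Lemma sorted_enum_ord N (S : {set 'I_N}) :
  sorted (fun i j : 'I_N => (i < j)%N) (enum S).
Proof.
rewrite /enum_mem; apply: sorted_filter; first exact: ltn_trans.
by rewrite -enumT -(@sorted_map _ _ val ltn) val_enum_ord iota_ltn_sorted.
Qed.

Lemma homo_ltn_inj n N (f : 'I_n -> 'I_N) :
  {homo f : i j / (i < j)%N} -> injective f.
Proof.
move=> homo_f i j fij; apply: val_inj; apply/eqP; rewrite eqn_leq.
by apply/andP; split; rewrite leqNgt; apply/negP => /homo_f; rewrite fij ltnn.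
Qed.

Lemma enum_imset_homo n N (f : 'I_n -> 'I_N) :
  {homo f : i j / (i < j)%N} -> enum [set f i | i in 'I_n] = map f (enum 'I_n).
Proof.
move=> homo_f; apply: (@irr_sorted_eq _ (fun i j : 'I_N => (i < j)%N)).
- exact: ltn_trans.
- by move=> i; rewrite /= ltnn.
- exact: sorted_enum_ord.
- rewrite sorted_map; apply: sub_sorted (_ : sorted (fun i j : 'I_n => (i < j)%N) _).
    by move=> i j; apply: homo_f.
  by rewrite -(@sorted_map _ _ val ltn) val_enum_ord iota_ltn_sorted.
by move=> i; rewrite mem_enum; apply/imsetP/mapP => -[j jn ->]; exists j => //;
  rewrite mem_enum.
Qed.

Lemma exists_enum_homo N (S : {set 'I_N}) n : #|S| = n ->
  exists2 f : 'I_n -> 'I_N, {homo f : i j / (i < j)%N} & S = [set f i | i in 'I_n].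
Proof.
move=> <-; exists enum_val.
  move=> i j ij; have x0 : 'I_N := enum_val i.
  rewrite !(enum_val_nth x0).
  apply: (sorted_ltn_nth _ _ (sorted_enum_ord S)) => //; first exact: ltn_trans.
    by rewrite inE -cardE.
  by rewrite inE -cardE.
apply/setP => x; apply/idP/imsetP => [xS | [i _ ->]]; last exact: enum_valP.
by exists (enum_rank_in xS x); rewrite ?enum_rankK_in.
Qed.

(** The induction that matches the expansion of Pfaffians along their least
    index. *)
Lemma set_ind_min N (P : {set 'I_N} -> Prop) : P set0 ->
    (forall (S : {set 'I_N}) a, a \in S -> {in S, forall x : 'I_N, (a <= x)%N} ->
       (forall T : {set 'I_N}, (#|T| < #|S|)%N -> P T) -> P S) ->
  forall S, P S.
Proof.
move=> P0 PS S; elim: {S}#|S| {-2}S (leqnn #|S|) => [|k IHk] S.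
  by rewrite leqn0 cards_eq0 => /eqP ->.
move=> cS; have [-> // | [x xS]] := set_0Vmem S.
case: (arg_minnP (fun i : 'I_N => i : nat) xS) => a aS min_a.
by apply: PS aS min_a _ => T cT; apply: IHk; rewrite -ltnS (leq_trans cT).
Qed.

Lemma card_setD2_lt N (S : {set 'I_N}) a b : a \in S -> (#|S :\ a :\ b| < #|S|)%N.
Proof.
by move=> aS; rewrite (cardsD1 a S) aS ltnS subset_leq_card // subsetDl.
Qed.

Section PfExpansion.
Variables (R : comNzRingType) (N : nat) (A : 'M[R]_N).

(** Any increasing enumeration of a set computes its Pfaffian; this avoids
    [enum_val], whose type depends on the cardinality of the set. *)
Lemma Pf_imset n (f : 'I_n -> 'I_N) : {homo f : i j / (i < j)%N} ->
  Pf A [set f i | i in 'I_n] = pfaffian (\matrix_(i, j) A (f i) (f j)).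
Proof.
move=> homo_f; have cS : #|[set f i | i in 'I_n]| = n.
  by rewrite card_imset ?card_ord //; apply: homo_ltn_inj.
have enum_valE i : enum_val i = f (cast_ord cS i).
  have x0 : 'I_N := enum_val i.
  rewrite (enum_val_nth x0) enum_imset_homo //.
  have lt_i : (i < n)%N := ltn_ord (cast_ord cS i).
  rewrite (nth_map (cast_ord cS i)) ?size_enum_ord //.
  by congr f; apply: val_inj; rewrite /= nth_enum_ord.
rewrite /Pf; move: enum_valE; move: (@enum_val _ _).
case: _ / (esym cS) (cS) => e g gE.
by congr pfaffian; apply/matrixP => i j; rewrite !mxE !gE !cast_ord_id.
Qed.

Lemma Pf_set0 : Pf A set0 = 1.
Proof.
have f0 : 'I_0 -> 'I_N by case.
have -> : set0 = [set f0 i | i in 'I_0].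
  by apply/setP => i; rewrite inE; apply/esym/imsetP => -[[]].
rewrite Pf_imset; last by case.
have S0 (s : 'S_0) : s = 1%g by apply/permP => -[].
rewrite /pfaffian /= (big_pred1 (1%g : 'S_0)) => [|s]; first by rewrite odd_perm1 big_ord0 mulr1.
by rewrite (S0 s) /= eqxx /matching_perm; apply/andP; split; apply/forallP => -[].
Qed.

Lemma Pf_odd (S : {set 'I_N}) : odd #|S| -> Pf A S = 0.
Proof. by rewrite /Pf /pfaffian => ->. Qed.

Lemma card_ord_gt n k : #|[set i : 'I_n | (k < i)%N]| = (n - k.+1)%N.
Proof.
rewrite -sum1_card (eq_bigl (fun i : 'I_n => true && (k < i)%N)).
  by rewrite -(big_geq_mkord k.+1 n xpredT (fun=> 1%N)) sum_nat_const_nat muln1.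
by move=> i; rewrite inE.
Qed.

Lemma above_imset n (f : 'I_n -> 'I_N) i : {homo f : i j / (i < j)%N} ->
  above [set f j | j in 'I_n] (f i) = (n - i.+1)%N.
Proof.
move=> homo_f; rewrite -card_ord_gt -(card_imset _ (homo_ltn_inj homo_f)).
apply: eq_card => x; rewrite inE; apply/andP/imsetP => [[/imsetP[j _ ->] fij] | [j]].
  exists j => //; rewrite inE ltnNge; apply: contraL fij => ji.
  by rewrite -leqNgt; move: ji; rewrite leq_eqVlt => /predU1P[/val_inj->//|/homo_f/ltnW].
by rewrite inE => ij ->; split; [apply: imset_f | apply: homo_f].
Qed.

(** The expansion along the first row, with signs that refer to [S] rather than
    to positions: for [#|S|] even, the number of elements of [S] between [a] and
    [b] has the parity of the number of those above [b]. *)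
Lemma Pf_min_expand (S : {set 'I_N}) (a : 'I_N) :
    a \in S -> {in S, forall x : 'I_N, (a <= x)%N} ->
  Pf A S = \sum_(b in S :\ a) (-1) ^+ above S b * A a b * Pf A (S :\ a :\ b).
Proof.
move=> aS min_a; have [oS | eS] := boolP (odd #|S|).
  rewrite Pf_odd // big1 // => b bS; rewrite (Pf_odd (S := S :\ a :\ b)) ?mulr0 //.
  have := cardsD1 a S; have := cardsD1 b (S :\ a); rewrite aS bS.
  by move=> -> E; move: oS; rewrite E; lia.
have [n cS] : exists n, #|S| = n.+2.
  have := cardsD1 a S; rewrite aS add1n => E.
  by move: eS; rewrite E; case: #|_| => // k _; exists k.
have [f homo_f defS] := exists_enum_homo cS.
have injf := homo_ltn_inj homo_f.
have f0 : f ord0 = a.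
  have: a \in [set f i | i in 'I_n.+2] by rewrite -defS.
  case/imsetP => i _ a_fi; apply: val_inj; apply/eqP; rewrite eqn_leq min_a ?andbT.
    rewrite a_fi; case: (posnP i) => [i0 | i_gt0]; last by apply/ltnW/homo_f.
    by rewrite (_ : ord0 = i) //; apply: val_inj.
  by rewrite defS imset_f.
have defSa : S :\ a = [set f (lift ord0 b) | b in 'I_n.+1].
  apply/setP => x; rewrite defS -f0 !inE; apply/andP/imsetP.
    case=> xf0 /imsetP[i _ xi]; move: xf0; rewrite xi (inj_eq injf) eq_sym.
    by case/unlift_some => j -> _; exists j.
  by case=> b _ ->; rewrite (inj_eq injf) eq_sym neq_lift imset_f.
rewrite {1}defS Pf_imset // pfaffian_row0 defSa big_imset /=; last first.
  by move=> b b' _ _ /injf/lift_inj.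
apply: eq_bigr => b _; rewrite !mxE f0; congr (_ * _ * _).
  have lt_b := ltn_ord b; have even_n : ~~ odd n by move: eS; rewrite cS /= negbK.
  rewrite {1}defS above_imset // -[LHS]signr_odd -[RHS]signr_odd; congr (_ ^+ _).
  by congr nat_of_bool; rewrite lift0; lia.
rewrite (_ : _ :\ _ = [set f (lift2 b i) | i in 'I_n]) ?Pf_imset.
- by congr pfaffian; apply/matrixP => i j; rewrite !mxE.
- by move=> i j ij; apply: homo_f; rewrite lift2_mono.
apply/setP => x; rewrite !inE; apply/andP/imsetP.
  case=> xb /imsetP[i _ xi]; move: xb; rewrite xi (inj_eq injf) eq_sym.
  by rewrite (inj_eq lift_inj) => /unlift_some[j -> _]; exists j.
case=> i _ ->; rewrite (inj_eq injf) (inj_eq lift_inj) eq_sym neq_lift; split=> //.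
by apply/imsetP; exists (lift b i).
Qed.

End PfExpansion.

(** * Exterior multiplication and contraction *)

(** Holds also when 2 is a zero divisor. *)
Lemma sum_alternating (V : zmodType) n (F : 'I_n -> 'I_n -> V) :
    (forall i, F i i = 0) -> (forall i j, F i j = - F j i) ->
  \sum_i \sum_j F i j = 0.
Proof.
elim: n F => [|n IHn] F F0 FC; first by rewrite big_ord0.
rewrite big_ord_recl big_ord_recl F0 add0r.
under [X in _ + X]eq_bigr do rewrite big_ord_recl.
rewrite big_split /= (IHn (fun i j => F (lift ord0 i) (lift ord0 j))) => //.
by rewrite addr0 -big_split big1 // => i _; rewrite /= (FC ord0) addNr.
Qed.

Section Exterior.
Variables (R : comNzRingType) (N : nat).
Local Notation form := {ffun {set 'I_N} -> R^o}.
Implicit Types (E : form) (U : {set 'I_N}) (i j l : 'I_N) (x y z : 'I_N -> R).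

Lemma above_setU1 U l i : l \notin U -> above (l |: U) i = ((i < l) + above U i)%N.
Proof.
move=> lU; rewrite /above; case il: (i < l)%N.
  rewrite (_ : [set _ in _ | _] = l |: [set j in U | (i < j)%N]) ?cardsU1 ?inE ?(negPf lU) //.
  by apply/setP => k; rewrite !inE; case: eqVneq => // ->.
by apply: eq_card => k; rewrite !inE; case: eqVneq => //= ->; rewrite il (negPf lU).
Qed.

Lemma above_setD1 U l i : i \in U -> above U l = ((l < i) + above (U :\ i) l)%N.
Proof. by move=> iU; rewrite -{1}(setD1K iU) above_setU1 // !inE eqxx. Qed.

Lemma ltn_ord_neq i j : i != j -> (i < j)%N = ~~ (j < i)%N.
Proof. by rewrite -(inj_eq val_inj); case: ltngtP. Qed.

(** Multiplication by [g_i] on the right. *)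
Definition rwedge i E : form :=
  [ffun U : {set 'I_N} => if i \in U then (-1) ^+ above U i * E (U :\ i) else 0].

(** Contraction from the right with the dual of [g_l]. *)
Definition rcontract l E : form :=
  [ffun U : {set 'I_N} => if l \in U then 0 else (-1) ^+ above U l * E (l |: U)].

Fact rwedge_is_linear i : linear (rwedge i).
Proof.
move=> a E E'; apply/ffunP => U; rewrite !ffunE; case: ifP => _; last by rewrite scaler0 addr0.
by rewrite /GRing.scale /= mulrDr mulrCA.
Qed.
HB.instance Definition _ i :=
  GRing.isLinear.Build R form form *:%R (rwedge i) (rwedge_is_linear i).

Fact rcontract_is_linear l : linear (rcontract l).
Proof.
move=> a E E'; apply/ffunP => U; rewrite !ffunE; case: ifP => _; first by rewrite scaler0 addr0.
by rewrite /GRing.scale /= mulrDr mulrCA.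
Qed.
HB.instance Definition _ l :=
  GRing.isLinear.Build R form form *:%R (rcontract l) (rcontract_is_linear l).

Lemma rwedge_sq i E : rwedge i (rwedge i E) = 0.
Proof. by apply/ffunP => U; rewrite !ffunE !inE eqxx /= mulr0 if_same. Qed.

Lemma rwedgeC i j E : rwedge i (rwedge j E) = - rwedge j (rwedge i E).
Proof.
have [<-|ij] := eqVneq i j; first by rewrite rwedge_sq oppr0.
apply/ffunP => U; rewrite !ffunE !inE ij eq_sym ij /=.
case: (boolP (i \in U)) => iU; case: (boolP (j \in U)) => jU; rewrite ?mulr0 ?oppr0 //.
rewrite !mulrA -!exprD -mulNr [U :\ j :\ i]setDDl setUC -setDDl; congr (_ * _).
rewrite (above_setD1 i jU) (above_setD1 j iU) -signr_odd -[(-1) ^+ (_ + above (U :\ j) i)]signr_odd.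
rewrite -signrN; congr (_ ^+ _); congr nat_of_bool.
rewrite !oddD !oddb (ltn_ord_neq ij).
by case: (j < i)%N; case: (odd _); case: (odd _).
Qed.

(** The Clifford relation between contraction and exterior multiplication; with
    [rwedgeC] it is all that is used of the exterior algebra later on. *)
Lemma rcontract_rwedge l i E :
  rcontract l (rwedge i E) = (l == i)%:R *: E - rwedge i (rcontract l E).
Proof.
apply/ffunP => U; rewrite !ffunE; have [<-|li] := eqVneq l i.
  rewrite /GRing.scale /= mul1r !inE eqxx /=; case: ifP => lU.
    rewrite setD1K // (above_setD1 _ lU) ltnn add0n mulrA -exprD addnn -signr_odd.
    by rewrite odd_double mul1r subrr.
  rewrite setU1K ?lU // above_setU1 ?lU // ltnn add0n mulrA -exprD addnn -signr_odd.
  by rewrite odd_double mul1r subr0.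
rewrite /GRing.scale /= mul0r add0r !inE [i == l]eq_sym (negPf li) /=.
case: (boolP (i \in U)) => iU; case: (boolP (l \in U)) => lU; rewrite ?mulr0 ?oppr0 //.
have -> : (l |: U) :\ i = l |: (U :\ i).
  by apply/setP => k; rewrite !inE; case: eqVneq => // ->; rewrite eq_sym (negPf li).
rewrite !mulrA -!exprD -mulNr; congr (_ * _).
rewrite (above_setD1 l iU) (above_setU1 i lU) -signr_odd -[(-1) ^+ (above U i + _)]signr_odd.
rewrite -signrN; congr (_ ^+ _); congr nat_of_bool.
rewrite !oddD !oddb (ltn_ord_neq li).
by case: (i < l)%N; case: (odd _); case: (odd _).
Qed.

Definition vwedge x E : form := \sum_i x i *: rwedge i E.

Lemma wedge_ext_vec (E : ext R N) x : wedge E (ext_vec x) = vwedge x E.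
Proof.
apply/ffunP => U; rewrite !ffunE sum_ffunE.
under [RHS]eq_bigr do rewrite !ffunE.
rewrite (eq_bigr (fun S => \sum_(i in U | S == U :\ i)
            (-1) ^+ above U i * (x i * E (U :\ i)))); last first.
  move=> S SU; rewrite /ext_vec sum_ffunE.
  under eq_bigr do rewrite !ffunE.
  rewrite !mulr_sumr [RHS]big_mkcond /=; apply: eq_bigr => i _.
  rewrite /GRing.scale /=.
  have -> : (U :\: S == [set i]) = (i \in U) && (S == U :\ i).
    apply/eqP/andP => [US | [iU /eqP ->]].
      have: i \in U :\: S by rewrite US inE eqxx.
      rewrite inE => /andP[_ iU].
      split=> //; apply/eqP; rewrite -US setDDr setDv set0U.
      by apply/esym/setIidPr.
    by apply/setP => k; rewrite !inE; case: eqVneq => [->|_]; rewrite /= ?iU ?andNb.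
  case: ifP => [/andP[iU /eqP ->]|_]; last by rewrite !mulr0.
  rewrite mulr1 [E _ * _]mulrC; congr ((-1) ^+ _ * _).
  have inj_pair : injective (fun a : 'I_N => (a, i)) by move=> a b [].
  rewrite /inversions /above -(card_imset _ inj_pair); apply: eq_card => -[a b].
  rewrite !inE /=; apply/and3P/imsetP => [[/andP[_ aU] /andP[bi bU] ba] | [a']].
    have ib : b = i by apply/eqP; move: bi; rewrite bU andbT negbK.
    by exists a; rewrite ?inE ?aU -?ib.
  rewrite inE => /andP[aU ia] [-> ->]; rewrite iU eqxx aU ia; split=> //.
  by rewrite andbT; apply: contraTneq ia => ->; rewrite ltnn.
rewrite (exchange_big_dep (fun i => i \in U)) /=; last by move=> S i _ /andP[].
rewrite [RHS]big_mkcond [LHS]big_mkcond /=; apply: eq_bigr => i _.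
case: ifP => iU; last by rewrite scaler0.
rewrite (big_pred1 (U :\ i)) => [|S]; first by rewrite /GRing.scale /= mulrCA.
by rewrite iU /=; case: eqP => [->|]; rewrite ?andbT ?andbF // subsetDl.
Qed.

Fact vwedge_is_linear x : linear (vwedge x).
Proof.
move=> a E E'; rewrite /vwedge scaler_sumr -big_split; apply: eq_bigr => i _ /=.
by rewrite linearP scalerDr !scalerA mulrC.
Qed.
HB.instance Definition _ x :=
  GRing.isLinear.Build R form form *:%R (vwedge x) (vwedge_is_linear x).

Lemma eq_vwedge x y E : x =1 y -> vwedge x E = vwedge y E.
Proof. by move=> xy; apply: eq_bigr => i _; rewrite xy. Qed.

Lemma vwedge_delta l a E :
  vwedge (fun i => (i == l)%:R * a) E = a *: rwedge l E.
Proof.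
rewrite /vwedge (bigD1 l) //= eqxx mul1r big1 ?addr0 // => i /negPf->.
by rewrite mul0r scale0r.
Qed.

Lemma vwedge_sq x E : vwedge x (vwedge x E) = 0.
Proof.
rewrite /vwedge; under eq_bigr do rewrite raddf_sum scaler_sumr /=.
apply: sum_alternating => [i|i j]; first by rewrite linearZ /= rwedge_sq !scaler0.
by rewrite !linearZ /= rwedgeC !scalerN !scalerA mulrC.
Qed.

Lemma rwedge_vwedge i x E : rwedge i (vwedge x E) = - vwedge x (rwedge i E).
Proof.
rewrite /vwedge raddf_sum /=.
under eq_bigr do rewrite linearZ /= rwedgeC scalerN.
rewrite sumrN; reflexivity.
Qed.

Lemma vwedgeC x y E : vwedge x (vwedge y E) = - vwedge y (vwedge x E).
Proof.
have -> : vwedge x (vwedge y E) = \sum_i x i *: rwedge i (vwedge y E) by [].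
have -> : vwedge x E = \sum_i x i *: rwedge i E by [].
rewrite (raddf_sum (vwedge y)) /=.
under eq_bigr do rewrite rwedge_vwedge scalerN -linearZ.
rewrite sumrN; reflexivity.
Qed.

Lemma rcontract_vwedge l x E :
  rcontract l (vwedge x E) = x l *: E - vwedge x (rcontract l E).
Proof.
rewrite /vwedge raddf_sum /=.
under eq_bigr do rewrite linearZ /= rcontract_rwedge scalerBr scalerA.
rewrite sumrB -scaler_suml; congr (_ - _); rewrite (bigD1 l) //= eqxx mulr1 big1 ?addr0 // => i.
by rewrite eq_sym => /negPf->; rewrite mulr0.
Qed.

End Exterior.

(** * Divided powers of a 2-form *)

Section DividedPowers.
Variables (R : comNzRingType) (N : nat) (A : 'M[R]_N).
Hypotheses (skewA : forall i j, A i j = - A j i) (diagA : forall i, A i i = 0).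
Local Notation form := {ffun {set 'I_N} -> R^o}.
Implicit Types (E : form) (S U : {set 'I_N}) (i j l : 'I_N) (x y z : 'I_N -> R).

(** The [k]-th divided power of the part of the 2-form that involves only the
    [g_i] with [a <= i]. *)
Definition divpow_ge a k : form :=
  [ffun S : {set 'I_N} =>
     if (#|S| == 2 * k)%N && [forall i in S, a <= i]%N then Pf A S else 0].

Lemma ext_divpowE k : ext_divpow A k = divpow_ge 0 k.
Proof.
apply/ffunP => S; rewrite sum_ffunE !ffunE.
rewrite (_ : [forall i in S, _]) ?andbT; last by apply/forall_inP.
under eq_bigr do rewrite !ffunE.
rewrite big_mkcond (bigD1 S) //= eqxx big1 ?addr0 => [|T /negPf].
  by case: ifP => // _; rewrite /GRing.scale /= mulr1.
by rewrite eq_sym => ->; rewrite scaler0 if_same.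
Qed.

Lemma divpow_ge0 a b : divpow_ge a 0 = divpow_ge b 0.
Proof.
apply/ffunP => S; rewrite !ffunE muln0 cards_eq0; case: eqP => [->|] //=.
by congr (if _ then _ else _); apply/forall_inP/forall_inP => _ i; rewrite inE.
Qed.

Lemma divpow_ge_max k : divpow_ge N k.+1 = 0.
Proof.
apply/ffunP => S; rewrite !ffunE; case: ifP => // /andP[/eqP cS /forall_inP geN].
have /card_gt0P[i /geN] : (0 < #|S|)%N by rewrite cS.
by rewrite leqNgt ltn_ord.
Qed.

Definition row_above (a : 'I_N) : 'I_N -> R := fun b => if (a < b)%N then A a b else 0.

(** The part of the 2-form on the indices [>= a] is the part on the indices
    [> a] plus a product [g_a /\ v], whose divided powers of order at least 2
    vanish; in coordinates this is the expansion of Pfaffians along the row of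
    their least index. *)
Lemma divpow_ge_rec (a : 'I_N) k :
  divpow_ge a k.+1 =
    divpow_ge a.+1 k.+1 + vwedge (row_above a) (rwedge a (divpow_ge a.+1 k)).
Proof.
apply/ffunP => S; rewrite ffunE [RHS]ffunE [in X in _ + X]/vwedge sum_ffunE.
under [X in _ + X]eq_bigr do rewrite !ffunE.
case: (boolP [forall i in S, (a <= i)%N]) => [/forall_inP Sa | nSa]; last first.
  rewrite andbF ffunE ifF ?add0r; last first.
    apply/negbTE/nandP; right; apply: contra nSa => /forall_inP Sa.
    by apply/forall_inP => i /Sa/ltnW.
  rewrite big1 // => b _; rewrite /row_above.
  case: ifP => ab; last by rewrite scale0r.
  case: ifP => bS; last by rewrite scaler0.
  case: ifP => aS; last by rewrite mulr0 scaler0.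
  rewrite ifF ?mulr0 ?scaler0 //; apply/negbTE/nandP; right.
  apply: contra nSa => /forall_inP Sa; apply/forall_inP => i iS.
  have [-> // | ia] := eqVneq i a; have [-> | ib] := eqVneq i b; first exact: ltnW.
  by apply/ltnW/Sa; rewrite !inE ia ib.
case: (boolP (a \in S)) => aS; last first.
  rewrite [X in _ + X]big1 ?addr0 => [|b _].
    rewrite ffunE andbT (_ : [forall i in S, _]) ?andbT //; apply/forall_inP => i iS.
    rewrite ltn_neqAle Sa // andbT (inj_eq val_inj); apply: contraNneq aS.
    by move->.
  by rewrite !inE (negPf aS) andbF mulr0 if_same scaler0.
have -> : divpow_ge a.+1 k.+1 S = 0.
  rewrite ffunE ifF //; apply/negbTE/nandP; right.
  by apply/forall_inP => /(_ a aS); rewrite ltnn.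
rewrite add0r andbT.
have cS b : b \in S -> b != a -> #|S| = #|S :\ b :\ a|.+2.
  by move=> bS ba; rewrite (cardsD1 b) bS (cardsD1 a (S :\ b)) !inE eq_sym ba aS.
have Sa1 b : b \in S -> [forall i in S :\ b :\ a, (a < i)%N].
  move=> bS; apply/forall_inP => i; rewrite !inE => /and3P[ia _ iS].
  by rewrite ltn_neqAle Sa // andbT (inj_eq val_inj) eq_sym.
case: ifP => [/eqP cS2k | /negP ncS]; last first.
  rewrite big1 // => b _; case: ifP => bS; last by rewrite scaler0.
  rewrite !inE aS andbT; case: eqVneq => [|ab]; rewrite ?mulr0 ?scaler0 //=.
  rewrite ifF ?mulr0 ?scaler0 //; apply/negbTE/nandP; left; apply/eqP => cSab.
  by apply: ncS; rewrite (cS b) ?cSab 1?eq_sym // mulnS.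
rewrite (Pf_min_expand A aS Sa) big_mkcond; apply: eq_bigr => b _.
rewrite !inE aS andbT.
have [-> | ba] := eqVneq b a; first by rewrite /row_above ltnn scale0r.
case: (boolP (b \in S)) => bS; last by rewrite scaler0.
have ab : (a < b)%N by rewrite ltn_neqAle Sa // andbT (inj_eq val_inj) eq_sym.
have cSb : #|S :\ b :\ a| = (2 * k)%N by move: cS2k; rewrite (cS b) // mulnS => -[].
rewrite /row_above ab /= cSb eqxx Sa1 //=.
rewrite (_ : above (S :\ b) a = (2 * k)%N); last first.
  rewrite -cSb; apply: eq_card => i; rewrite !inE.
  apply/andP/andP => [[/andP[ib iS] ai] | [ia /andP[-> iS]]].
    by rewrite ib iS; split=> //; apply: contraTneq ai => ->; rewrite ltnn.
  by rewrite iS; split=> //; rewrite ltn_neqAle Sa // andbT (inj_eq val_inj) eq_sym.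
rewrite exprM sqrrN !expr1n mul1r /GRing.scale /= [S :\ a :\ b]setDDl setUC -setDDl.
by rewrite -mulrA mulrCA.
Qed.

Lemma rcontract_divpow0 l a : rcontract l (divpow_ge a 0) = 0.
Proof.
apply/ffunP => S; rewrite !ffunE; case: (boolP (l \in S)) => lS //.
by rewrite ifF ?mulr0 // cardsU1 lS.
Qed.

(** Contraction is a derivation, and contracting the 2-form itself with the dual
    of [g_l] gives the column [l] of [A].  In coordinates this is the expansion
    of Pfaffians along an arbitrary row; the induction adds the indices [a] one
    by one, from the largest down. *)
Lemma rcontract_divpow_ge l a k : (a <= N)%N ->
  rcontract l (divpow_ge a k.+1) =
    vwedge (fun i => if (a <= i)%N && (a <= l)%N then A i l else 0) (divpow_ge a k).
Proof.
elim: {a}(N - a)%N {-2}a (erefl (N - a)%N) l k => [|d IHd] a Da l k le_aN.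
  have ->: a = N by lia.
  rewrite divpow_ge_max linear0 (@eq_vwedge _ _ _ (fun i => (i == l)%:R * 0)).
    by rewrite vwedge_delta scale0r.
  by move=> i; rewrite leqNgt ltn_ord mulr0.
have lt_aN : (a < N)%N by lia.
pose b := Ordinal lt_aN; have -> : a = b by [].
set w := fun i => _; pose w' i := if (b < i)%N && (b < l)%N then A i l else 0.
pose Q := divpow_ge b.+1; pose v := row_above b.
have IH k' : rcontract l (Q k'.+1) = vwedge w' (Q k') by apply: IHd; rewrite /=; lia.
(* The column l cut at b exceeds the one cut at b + 1 by its entry in row b if
   b < l; if l = b, it is minus the row b. *)
have wE : w =1 fun i => w' i + ((i == b)%:R * v l - (l == b)%:R * v i).
  move=> i; rewrite /w /w' /v /row_above; have [-> | lb] := eqVneq l b.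
    rewrite !ltnn leqnn andbF andbT add0r mulr0 sub0r mul1r.
    rewrite leq_eqVlt (inj_eq val_inj); case: (eqVneq b i) => [<- | _] /=.
      by rewrite ltnn oppr0.
    by case: ifP; rewrite ?oppr0.
  rewrite mul0r subr0 [(b <= l)%N]leq_eqVlt; case: eqP => [/val_inj bl | _] /=.
    by rewrite bl eqxx in lb.
  case: (b < l)%N; last by rewrite !andbF add0r mulr0.
  rewrite !andbT [(b <= i)%N]leq_eqVlt (inj_eq val_inj).
  case: (eqVneq b i) => [<- | _] /=; first by rewrite ltnn mul1r add0r.
  by rewrite mul0r addr0.
have rP k' : rwedge b (divpow_ge b k') = rwedge b (Q k').
  case: k' => [|k']; first by rewrite /Q (divpow_ge0 b b.+1).
  by rewrite divpow_ge_rec linearD /= rwedge_vwedge rwedge_sq linear0 oppr0 addr0.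
have vP k' : vwedge v (divpow_ge b k') = vwedge v (Q k').
  case: k' => [|k']; first by rewrite /Q (divpow_ge0 b b.+1).
  by rewrite divpow_ge_rec linearD /= vwedge_sq addr0.
have w'P : vwedge w' (divpow_ge b k) =
    vwedge w' (Q k) + vwedge v (rwedge b (rcontract l (Q k))).
  case: k => [|k].
    by rewrite /Q rcontract_divpow0 !linear0 addr0 (divpow_ge0 b b.+1).
  rewrite divpow_ge_rec linearD IH rwedge_vwedge linearN /= -/v -/Q; congr (_ + _).
  by rewrite vwedgeC.
have vwedgeD x y E : vwedge (fun i => x i + y i) E = vwedge x E + vwedge y E.
  by rewrite /vwedge -big_split; apply: eq_bigr => i _; rewrite scalerDl.
have vwedgeZ c x E : vwedge (fun i => c * x i) E = c *: vwedge x E.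
  by rewrite /vwedge scaler_sumr; apply: eq_bigr => i _; rewrite scalerA.
rewrite (eq_vwedge _ wE) !vwedgeD vwedge_delta w'P rP.
rewrite (@eq_vwedge _ _ (fun i => - ((l == b)%:R * v i))
           (fun i => - (l == b)%:R * v i)) => [|i]; last by rewrite mulNr.
rewrite vwedgeZ vP divpow_ge_rec linearD /= IH -/Q -/v rcontract_vwedge rcontract_rwedge.
rewrite linearB linearZ /= scaleNr opprB -[RHS]addrA; congr (_ + _).
exact: addrCA.
Qed.

End DividedPowers.

(** * Identities in top degree *)

Section Trilinear.
Variables (R : comNzRingType) (N m : nat) (A : 'M[R]_N).
Hypotheses (skewA : forall i j, A i j = - A j i) (diagA : forall i, A i i = 0).
Hypotheses (m_gt0 : (0 < m)%N) (oddN : N = (2 * m + 1)%N).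
Local Notation form := {ffun {set 'I_N} -> R^o}.
Implicit Types (E : form) (S U : {set 'I_N}) (i j l : 'I_N) (x y z w : 'I_N -> R).

Definition homog_form d E := forall S, #|S| != d -> E S = 0.

Lemma homog_vwedge d x E : homog_form d E -> homog_form d.+1 (vwedge x E).
Proof.
move=> homE S cS; rewrite sum_ffunE big1 // => i _; rewrite !ffunE.
case: ifP => iS; last by rewrite scaler0.
by rewrite homE ?mulr0 ?scaler0 //; apply: contra_neq cS => <-; rewrite (cardsD1 i S) iS.
Qed.

Lemma homog_form_eq0 d E : (N < d)%N -> homog_form d E -> E = 0.
Proof.
move=> ltNd homE; apply/ffunP => S; rewrite homE ?ffunE // neq_ltn.
by rewrite (leq_ltn_trans _ ltNd) // -[N in (_ <= N)%N]card_ord max_card.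
Qed.

Definition divpow k : form := ext_divpow A k.

Lemma homog_divpow k : homog_form (2 * k) (divpow k).
Proof.
by move=> S /negPf cS; rewrite /divpow ext_divpowE ffunE cS.
Qed.

Lemma rcontract_divpow l k :
  rcontract l (divpow k.+1) = vwedge (A^~ l) (divpow k).
Proof.
by rewrite /divpow !ext_divpowE rcontract_divpow_ge.
Qed.

Definition pf_vec i : R := rwedge i (divpow m) [set: 'I_N].

Definition pf_lin x : R := vwedge x (divpow m) [set: 'I_N].

Definition pf_tri x y z : R :=
  vwedge z (vwedge y (vwedge x (divpow (m - 1)))) [set: 'I_N].

Lemma ext_top_pf_lin x : ext_top (wedge (ext_divpow A m) (ext_vec x)) = pf_lin x.
Proof. by rewrite wedge_ext_vec. Qed.

Lemma ext_top_pf_tri x y z :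
  ext_top (wedge (wedge (wedge (ext_divpow A (m - 1)) (ext_vec x)) (ext_vec y)) (ext_vec z)) =
  pf_tri x y z.
Proof. by rewrite !wedge_ext_vec. Qed.

Lemma pf_linE x : pf_lin x = \sum_i x i * pf_vec i.
Proof. by rewrite /pf_lin sum_ffunE; apply: eq_bigr => i _; rewrite ffunE. Qed.

Lemma pf_tri_suml x y z :
  pf_tri x y z = \sum_i x i * pf_tri (fun j => (j == i)%:R) y z.
Proof.
rewrite /pf_tri (_ : vwedge x _ =
   \sum_i x i *: vwedge (fun j => (j == i)%:R) (divpow (m - 1))).
  rewrite (raddf_sum (vwedge y)) /= (raddf_sum (vwedge z)) /= sum_ffunE.
  by apply: eq_bigr => i _; rewrite !linearZ /= ffunE.
apply: eq_bigr => i _; congr (_ *: _).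
rewrite -[LHS]scale1r -vwedge_delta; apply: eq_vwedge => j.
by rewrite mulr1.
Qed.

Lemma pf_triC12 x y z : pf_tri x y z = - pf_tri y x z.
Proof. by rewrite /pf_tri [vwedge y _]vwedgeC linearN /= !ffunE. Qed.

Lemma pf_triC23 x y z : pf_tri x y z = - pf_tri x z y.
Proof. by rewrite /pf_tri vwedgeC !ffunE. Qed.

Lemma pf_tri0_12 x z : pf_tri x x z = 0.
Proof. by rewrite /pf_tri vwedge_sq linear0 ffunE. Qed.

Lemma pf_tri0_23 x y : pf_tri x y y = 0.
Proof. by rewrite /pf_tri vwedge_sq ffunE. Qed.

(** This is the contraction of the [m.+1]-st divided power, which vanishes since
    its degree exceeds [N]. *)
Lemma pf_vec_ker l : \sum_i A i l * pf_vec i = 0.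
Proof.
rewrite -pf_linE /pf_lin -rcontract_divpow (_ : divpow m.+1 = 0) ?linear0 ?ffunE //.
by apply: (homog_form_eq0 _ (@homog_divpow m.+1)); rewrite oddN; lia.
Qed.

(** Contract the vanishing form [C^m /\ x /\ w] of degree [N + 1]. *)
Lemma pf_tri_row l x w : pf_tri (A^~ l) x w = x l * pf_lin w - w l * pf_lin x.
Proof.
have : rcontract l (vwedge w (vwedge x (divpow m))) = 0.
  rewrite (_ : vwedge w _ = 0) ?linear0 //; apply: (@homog_form_eq0 (2 * m).+2).
    by rewrite oddN; lia.
  by apply/homog_vwedge/homog_vwedge/homog_divpow.
rewrite !rcontract_vwedge -[in rcontract l (divpow m)](subnK m_gt0) addn1 rcontract_divpow.
move=> /ffunP/(_ [set: 'I_N]); rewrite !(linearB, linearZ) /= !ffunE.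
rewrite -/(pf_lin w) -/(pf_lin x) -/(pf_tri _ _ _) /GRing.scale /= => H.
by apply/eqP; rewrite -subr_eq0 -H; apply/eqP; ring.
Qed.

(** Contraction with the linear form whose coefficients are the Pfaffians
    [pf_vec]. *)
Definition pcontract E : form := \sum_l pf_vec l *: rcontract l E.

Lemma pcontract_vwedge x E : pcontract (vwedge x E) = pf_lin x *: E - vwedge x (pcontract E).
Proof.
rewrite /pcontract (raddf_sum (vwedge x)) /=.
under eq_bigr do rewrite rcontract_vwedge scalerBr scalerA.
rewrite sumrB -scaler_suml pf_linE; congr (_ + _).
  by congr (_ *: _); apply: eq_bigr => i _; rewrite mulrC.
by congr (- _); apply: eq_bigr => i _; rewrite linearZ.
Qed.

(** Contracting the 2-form with a vector gives its image under [A], and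
    [pf_vec] spans the kernel of [A]. *)
Lemma pcontract_divpow k : pcontract (divpow k) = 0.
Proof.
case: k => [|k].
  by rewrite /pcontract big1 // => l _; rewrite /divpow ext_divpowE rcontract_divpow0 scaler0.
rewrite /pcontract; under eq_bigr do rewrite rcontract_divpow scaler_sumr.
rewrite exchange_big big1 // => i _ /=.
under eq_bigr do rewrite scalerA; rewrite -scaler_suml.
rewrite (eq_bigr (fun l => - (A l i * pf_vec l))) => [|l _]; last by rewrite skewA mulrN mulrC.
by rewrite sumrN pf_vec_ker oppr0 scale0r.
Qed.

(** Apply [pcontract] to the vanishing form [C^(m-1) /\ x /\ y /\ z /\ w]. *)
Lemma pf_tri_plucker x y z w :
  pf_lin x * pf_tri y z w - pf_lin y * pf_tri x z w
    + pf_lin z * pf_tri x y w - pf_lin w * pf_tri x y z = 0.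
Proof.
have : pcontract (vwedge w (vwedge z (vwedge y (vwedge x (divpow (m - 1)))))) = 0.
  rewrite (_ : vwedge w _ = 0).
    by rewrite /pcontract big1 // => l _; rewrite linear0 scaler0.
  apply: (@homog_form_eq0 (2 * (m - 1)).+4); first by rewrite oddN; lia.
  by do 4!apply: homog_vwedge; apply: homog_divpow.
rewrite !pcontract_vwedge pcontract_divpow linear0 subr0.
move=> /ffunP/(_ [set: 'I_N]); rewrite !(linearB, linearZ) /= !ffunE.
rewrite -!/(pf_tri _ _ _) /GRing.scale /= => H.
by rewrite -oppr0 -H; ring.
Qed.

End Trilinear.

(** * The complex and its homotopies *)

Lemma ord3_ind (P : 'I_3 -> Prop) : P k1 -> P k2 -> P k3 -> forall i, P i.
Proof.
move=> P1 P2 P3 [[|[|[|//]]] lti].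
- by rewrite (_ : Ordinal _ = k1) //; apply: val_inj.
- by rewrite (_ : Ordinal _ = k2) //; apply: val_inj.
- by rewrite (_ : Ordinal _ = k3) //; apply: val_inj.
Qed.

Lemma sum_ord3 (V : nmodType) (F : 'I_3 -> V) : \sum_i F i = F k1 + F k2 + F k3.
Proof.
rewrite !big_ord_recl big_ord0 addr0 addrA.
by congr (F _ + F _ + F _); apply: val_inj.
Qed.

Lemma ord3_eqE : ((k1 == k2) = false) * ((k1 == k3) = false) * ((k2 == k1) = false)
  * ((k2 == k3) = false) * ((k3 == k1) = false) * ((k3 == k2) = false).
Proof. by []. Qed.

(** The matrix of the cross product with [a]. *)
Definition cross_mx (R : pzRingType) (a : 'I_3 -> R) : 'M[R]_3 :=
  \matrix_(i, j) match val i, val j with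
    | 0, 1 => a k3 | 0, 2 => - a k2
    | 1, 0 => - a k3 | 1, 2 => a k1
    | 2, 0 => a k2 | 2, 1 => - a k1
    | _, _ => 0
    end.

Section Complex.
Variables (R : comNzRingType) (N m : nat) (A : 'M[R]_N) (U : 'M[R]_(3, N)).
Hypotheses (skewA : forall i j, A i j = - A j i) (diagA : forall i, A i i = 0).
Hypotheses (m_gt0 : (0 < m)%N) (oddN : N = (2 * m + 1)%N).

Let T := pf_tri m A.
Let g (i : 'I_N) : 'I_N -> R := fun j => (j == i)%:R.

Definition lin_gen (k : 'I_3) : R := pf_lin m A (U k).
Definition tri_gen : R := T (U k1) (U k2) (U k3).

Definition pf_col : 'cV[R]_N := \col_i pf_vec m A i.
Definition tri_mx (k : 'I_3) : 'M[R]_N := \matrix_(i, j) T (g i) (g j) (U k).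
(** Column [j] is [T (g i) (U l) (U k)] with [(j, k, l)] a cyclic permutation of
    the three indices. *)
Definition tri_cols : 'M[R]_(N, 3) :=
  \matrix_(i, j) match val j with
    | 0 => T (g i) (U k3) (U k2)
    | 1 => T (g i) (U k1) (U k3)
    | _ => T (g i) (U k2) (U k1)
    end.

Definition res_d2 : 'M[R]_(N, N + 3) := row_mx A U^T.
Definition res_d1 : 'M[R]_(N + 3, 1 + 3) :=
  block_mx pf_col tri_cols 0 (cross_mx lin_gen).
Definition res_d0 : 'M[R]_(1 + 3, 1) := col_mx tri_gen%:M (\col_k lin_gen k).

(** The homotopy [htpy0], [htpy1], [htpy2] is multiplication by the basis vector
    over [lin_gen k] for the product of a differential graded algebra on the
    resolution; its middle part contains the Koszul relations among the
    [lin_gen], and its last part is assembled from the Pfaffian adjoint of the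
    matrix [A] bordered by the row [k] of [U]. *)
Definition htpy0 (k : 'I_3) : 'M[R]_(1, 1 + 3) := row_mx 0 (delta_mx 0 k).
Definition htpy1 (k : 'I_3) : 'M[R]_(1 + 3, N + 3) :=
  block_mx (row k U) 0 0 (- cross_mx (fun i => (i == k)%:R)).
Definition htpy2 (k : 'I_3) : 'M[R]_(N + 3, N) :=
  col_mx (- tri_mx k) (delta_mx k 0 *m pf_col^T).

Lemma pf_lin_delta i : pf_lin m A (g i) = pf_vec m A i.
Proof.
rewrite pf_linE (bigD1 i) //= /g eqxx mul1r big1 ?addr0 // => j /negPf->.
by rewrite mul0r.
Qed.

Lemma tri_suml y z (x : 'I_N -> R) : \sum_i x i * T (g i) y z = T x y z.
Proof. by rewrite /T [RHS]pf_tri_suml. Qed.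

Lemma mul_skew_pf_col : A *m pf_col = 0.
Proof.
apply/matrixP => l j; rewrite !mxE.
under eq_bigr do rewrite mxE skewA mulNr.
by rewrite sumrN pf_vec_ker ?oppr0.
Qed.

Lemma mul_pf_col_skew : pf_col^T *m A = 0.
Proof.
apply/matrixP => j l; rewrite !mxE.
by under eq_bigr do rewrite !mxE mulrC; rewrite pf_vec_ker.
Qed.

Lemma mul_row_pf_col k : row k U *m pf_col = (lin_gen k)%:M.
Proof.
apply/matrixP => i j; rewrite !ord1 !mxE /lin_gen pf_linE mulr1n.
by apply: eq_bigr => l _; rewrite !mxE.
Qed.

Lemma mul_U_pf_col : U *m pf_col = \col_k lin_gen k.
Proof.
apply/matrixP => i j; rewrite !mxE /lin_gen pf_linE.
by apply: eq_bigr => l _; rewrite !mxE.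
Qed.

Lemma skew_tri l y z : \sum_i A l i * T (g i) y z = - T (A^~ l) y z.
Proof.
rewrite -tri_suml -sumrN; apply: eq_bigr => i _.
by rewrite skewA mulNr.
Qed.

(** Up to sign, a block of the identity by which the product of a skew matrix
    with its Pfaffian adjoint is its Pfaffian, for [A] bordered by the row [k]
    of [U]. *)
Lemma mul_skew_tri_mx k :
  A *m tri_mx k = (row k U)^T *m pf_col^T - (lin_gen k)%:M.
Proof.
apply/matrixP => l i; rewrite !mxE big_ord1 !mxE.
under eq_bigr do rewrite mxE.
rewrite skew_tri /T pf_tri_row // pf_lin_delta -/(lin_gen k) /g eq_sym.
by case: eqP => _; rewrite ?mul1r ?mul0r opprB.
Qed.

Lemma tr_tri_mx k : (tri_mx k)^T = - tri_mx k.
Proof. by apply/matrixP => i j; rewrite !mxE /T pf_triC12. Qed.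

Lemma mul_tri_mx_skew k :
  tri_mx k *m A = pf_col *m row k U - (lin_gen k)%:M.
Proof.
have trA : A^T = - A by apply/matrixP => i j; rewrite !mxE skewA.
apply: trmx_inj; rewrite trmx_mul tr_tri_mx trA mulmxN mulNmx opprK mul_skew_tri_mx.
by rewrite linearB /= trmx_mul tr_scalar_mx.
Qed.

Lemma mul_tri_mx_U k i l : (tri_mx k *m U^T) i l = T (g i) (U l) (U k).
Proof.
transitivity (- T (U l) (g i) (U k)); last by rewrite /T [RHS]pf_triC12.
rewrite !mxE -tri_suml -sumrN; apply: eq_bigr => j _.
by rewrite !mxE /T pf_triC12 mulNr mulrC.
Qed.

Lemma mul_row_tri_cols k : row k U *m tri_cols = - tri_gen *: delta_mx 0 k.
Proof.
apply/matrixP => i j; rewrite !mxE ord1 eqxx /=; elim/ord3_ind: j => /=.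
- under eq_bigr do rewrite !mxE /=.
  rewrite tri_suml /tri_gen /T; elim/ord3_ind: k; rewrite ?pf_tri0_12 ?pf_tri0_23 ?mulr0 //.
    by rewrite mulr1 pf_triC23.
  by rewrite pf_triC23 pf_tri0_12 oppr0.
- under eq_bigr do rewrite !mxE /=.
  rewrite tri_suml /tri_gen /T; elim/ord3_ind: k; rewrite ?pf_tri0_12 ?pf_tri0_23 ?mulr0 //.
    by rewrite mulr1 pf_triC12.
  by rewrite pf_triC23 pf_tri0_12 oppr0.
under eq_bigr do rewrite !mxE /=.
rewrite tri_suml /tri_gen /T; elim/ord3_ind: k; rewrite ?pf_tri0_12 ?pf_tri0_23 ?mulr0 //.
  by rewrite pf_triC23 pf_tri0_12 oppr0.
by rewrite mulr1 pf_triC12 pf_triC23 pf_triC12 opprK.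
Qed.

Lemma res_d2d1 : res_d2 *m res_d1 = 0.
Proof.
rewrite mul_row_block mul_skew_pf_col mulmx0 addr0.
suff -> : A *m tri_cols + U^T *m cross_mx lin_gen = 0 by rewrite row_mx0.
apply/matrixP => l j; rewrite [LHS]mxE !mxE sum_ord3; elim/ord3_ind: j;
  under eq_bigr do rewrite mxE /=; rewrite skew_tri /T pf_tri_row // !mxE /= /lin_gen; ring.
Qed.

Lemma res_d1d0 : res_d1 *m res_d0 = 0.
Proof.
rewrite mul_block_col mul0mx add0r.
suff [-> ->] : pf_col *m tri_gen%:M + tri_cols *m (\col_k lin_gen k) = 0
    /\ cross_mx lin_gen *m (\col_k lin_gen k) = 0 by rewrite col_mx0.
split; apply/matrixP => i j; rewrite !mxE.
  rewrite big_ord1 sum_ord3 !mxE !ord1 /= ?eqxx ?mulr1n.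
  have := pf_tri_plucker skewA diagA m_gt0 oddN (g i) (U k1) (U k2) (U k3).
  rewrite pf_lin_delta -/T -/tri_gen -!/(lin_gen _) => H.
  rewrite -H /T (pf_triC23 _ _ (g i) (U k3)) (pf_triC23 _ _ (g i) (U k2) (U k1)).
  ring.
by rewrite sum_ord3; elim/ord3_ind: i; rewrite !mxE /=; ring.
Qed.

Lemma cross_mxM (k : 'I_3) (a : 'I_3 -> R) :
  - cross_mx (fun i => (i == k)%:R) *m cross_mx a =
  (a k)%:M - (\col_i a i) *m delta_mx 0 k.
Proof.
apply/matrixP => i j; rewrite !mxE big_ord1 sum_ord3 !mxE.
by elim/ord3_ind: i; elim/ord3_ind: j; elim/ord3_ind: k;
  rewrite !eqxx ?ord3_eqE /= ?mulr1n ?mulr0n; ring.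
Qed.

Lemma res_htpy1 k : res_d0 *m htpy0 k + htpy1 k *m res_d1 = (lin_gen k)%:M.
Proof.
rewrite mul_col_row mulmx_block !mul0mx !mulmx0 !add0r !addr0 mul_row_pf_col.
rewrite mul_row_tri_cols cross_mxM add_block_mx !add0r mul_scalar_mx scaleNr subrr.
by rewrite addrC subrK scalar_mx_block.
Qed.

Lemma cross_mxM_tr (k : 'I_3) (a : 'I_3 -> R) :
  cross_mx a *m - cross_mx (fun i => (i == k)%:R) =
  (a k)%:M - delta_mx k 0 *m (\col_i a i)^T.
Proof.
have trC b : (cross_mx b)^T = - cross_mx b :> 'M[R]_3.
  by apply/matrixP => i j; rewrite !mxE; elim/ord3_ind: i; elim/ord3_ind: j;
    rewrite /= ?oppr0 ?opprK.
apply: trmx_inj; rewrite trmx_mul linearN /= !trC opprK mulmxN -mulNmx cross_mxM.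
by rewrite linearB /= tr_scalar_mx trmx_mul trmxK trmx_delta.
Qed.

Lemma tri_cols_cross k :
  tri_cols *m - cross_mx (fun i => (i == k)%:R) = tri_mx k *m U^T.
Proof.
apply/matrixP => i l; rewrite mul_tri_mx_U !mxE sum_ord3 !mxE.
elim/ord3_ind: k; elim/ord3_ind: l; rewrite !eqxx ?ord3_eqE /=
  ?oppr0 ?mulr0 ?addr0 ?add0r ?opprK ?mulr1 ?mulrN1 //;
  by rewrite /T ?pf_tri0_23 // [RHS]pf_triC23 ?opprK.
Qed.

Lemma res_htpy2 k : res_d1 *m htpy1 k + htpy2 k *m res_d2 = (lin_gen k)%:M.
Proof.
rewrite mulmx_block mul_col_row !mul0mx !mulmx0 !add0r !addr0 add_block_mx.
rewrite tri_cols_cross cross_mxM_tr !mulNmx mul_tri_mx_skew subrr -!mulmxA.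
rewrite mul_pf_col_skew mulmx0 addr0 -[pf_col^T *m _]trmxK trmx_mul !trmxK mul_U_pf_col.
by rewrite subrK opprB addrC subrK scalar_mx_block.
Qed.

Lemma res_htpy3 k : res_d2 *m htpy2 k = (lin_gen k)%:M.
Proof.
rewrite mul_row_col mulmxN mul_skew_tri_mx opprB mulmxA.
rewrite (_ : U^T *m delta_mx k 0 = (row k U)^T) ?subrK //.
by apply: trmx_inj; rewrite trmx_mul !trmxK trmx_delta rowE.
Qed.

End Complex.

(** * Regular sequences and exactness of complexes *)

Section IdealSpan.
Variable R : comNzRingType.
Implicit Types (s : seq R) (a x y : R).

Lemma ideal_spanP s x :
  reflect (exists a : 'I_(size s) -> R, x = \sum_i a i * s`_i) (x \in ideal_span s).
Proof. exact: asboolP. Qed.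

Lemma ideal_span_add s x y :
  x \in ideal_span s -> y \in ideal_span s -> x + y \in ideal_span s.
Proof. exact: (@rpredD _ (ideal_span s)). Qed.

Lemma ideal_span_sub s x y :
  x \in ideal_span s -> y \in ideal_span s -> x - y \in ideal_span s.
Proof. exact: (@rpredB _ (ideal_span s)). Qed.

Lemma ideal_span_mull s a x : x \in ideal_span s -> a * x \in ideal_span s.
Proof. exact: (@rpredZ _ _ (ideal_span s)). Qed.

Lemma ideal_span_mulr s a x : x \in ideal_span s -> x * a \in ideal_span s.
Proof. by rewrite mulrC; apply: ideal_span_mull. Qed.

Lemma ideal_span0 s : 0 \in ideal_span s.
Proof. exact: (@rpred0 _ (ideal_span s)). Qed.

Lemma ideal_span_sum s (I : Type) (r : seq I) (P : pred I) (F : I -> R) :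
  (forall i, P i -> F i \in ideal_span s) -> \sum_(i <- r | P i) F i \in ideal_span s.
Proof. exact: (@rpred_sum _ (ideal_span s)). Qed.

Lemma ideal_span_nth s i : (i < size s)%N -> s`_i \in ideal_span s.
Proof.
move=> lt_i; apply/ideal_spanP; exists (fun j => (val j == i)%:R).
rewrite (bigD1 (Ordinal lt_i)) //= eqxx mul1r big1 ?addr0 // => j.
by rewrite -(inj_eq val_inj) => /negPf /= ->; rewrite mul0r.
Qed.

Lemma ideal_span_min s s' :
  (forall i, (i < size s)%N -> s`_i \in ideal_span s') -> {subset ideal_span s <= ideal_span s'}.
Proof.
move=> ss' x /ideal_spanP[a ->]; apply: ideal_span_sum => i _.
by apply/ideal_span_mull/ss'.
Qed.

Lemma ideal_span_nil x : x \in ideal_span [::] -> x = 0.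
Proof. by case/ideal_spanP => a ->; rewrite big_ord0. Qed.

Lemma ideal_span_rcons s t x : x \in ideal_span (rcons s t) ->
  exists c, x - t * c \in ideal_span s.
Proof.
case/ideal_spanP => a ->; have lt_s : (size s < size (rcons s t))%N by rewrite size_rcons.
exists (a (Ordinal lt_s)); rewrite (bigD1 (Ordinal lt_s)) //= nth_rcons ltnn eqxx.
rewrite [t * _]mulrC addrAC subrr add0r; apply: ideal_span_sum => i i_s.
have lt_i : (i < size s)%N.
  have : (i < (size s).+1)%N by rewrite -(size_rcons s t) ltn_ord.
  rewrite ltnS leq_eqVlt => /predU1P[i_eq | //].
  by case/eqP: i_s; apply: val_inj.
by rewrite nth_rcons lt_i; apply/ideal_span_mull/ideal_span_nth.
Qed.

Lemma ideal_span_takeS s j x : (j < size s)%N -> x \in ideal_span (take j.+1 s) ->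
  exists c, x - s`_j * c \in ideal_span (take j s).
Proof. by move=> lt_j; rewrite (take_nth 0 lt_j) => /ideal_span_rcons. Qed.

Lemma sub_ideal_span_takeS s j : {subset ideal_span (take j s) <= ideal_span (take j.+1 s)}.
Proof.
apply: ideal_span_min => i; rewrite size_take_min => lt_i.
have [lt_ij lt_is] : (i < j /\ i < size s)%N by split; lia.
rewrite nth_take // -(@nth_take j.+1 _ _ i) ?(ltn_trans lt_ij) //.
by apply: ideal_span_nth; rewrite size_take_min; lia.
Qed.

Definition rV_in s n (x : 'rV[R]_n) := forall k, x 0 k \in ideal_span s.

Lemma rV_in_mul s n p (x : 'rV[R]_n) (M : 'M_(n, p)) : rV_in s x -> rV_in s (x *m M).
Proof. by move=> xs k; rewrite mxE; apply: ideal_span_sum => i _; apply: ideal_span_mulr. Qed.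

Lemma rV_in_add s n (x y : 'rV[R]_n) : rV_in s x -> rV_in s y -> rV_in s (x + y).
Proof. by move=> xs ys k; rewrite mxE ideal_span_add. Qed.

Lemma rV_in_sub s n (x y : 'rV[R]_n) : rV_in s x -> rV_in s y -> rV_in s (x - y).
Proof. by move=> xs ys k; rewrite !mxE ideal_span_sub. Qed.

Definition weakly_regular s := forall i, (i < size s)%N ->
  forall x, s`_i * x \in ideal_span (take i s) -> x \in ideal_span (take i s).

(** Let [i] stand for the position and [j] for the number of elements of [s]
    already factored out.  If [x] is a cocycle modulo the first [j] elements and
    [c] is the next one, then [c x] is a coboundary because [c] is
    null-homotopic, say of [y]; and [y] is a cocycle modulo one more element.
    By induction [y] is a coboundary plus [c w], so [c x] is [c] times the
    coboundary of [w], and [c] can be cancelled.  In the first position there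
    is no room for [y], so [x] itself vanishes. *)
Lemma complex_exact_mod s (r : nat -> nat) (M : forall i, 'M[R]_(r i, r i.+1)) :
    weakly_regular s -> r 0%N = 0%N -> (forall i, M i *m M i.+1 = 0) ->
    (forall i j, (i + j < size s)%N ->
       exists g h, g *m M i + M i.+1 *m h = (s`_j)%:M) ->
  forall i j, (i + j < size s)%N -> forall x : 'rV_(r i.+1),
    rV_in (take j s) (x *m M i.+1) ->
  exists w, rV_in (take j s) (x - w *m M i).
Proof.
move=> reg r0 MM htpy; elim=> [|i IHi] j lt_ij x xM.
  have [g [h gh]] := htpy _ _ lt_ij; exists 0; rewrite mul0mx subr0 => k.
  apply: reg => //; have := congr1 (mulmx x) gh.
  rewrite mulmxDr !mulmxA mul_mx_scalar => /matrixP/(_ 0 k); rewrite !mxE => <-.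
  rewrite big1 ?add0r => [|l _]; last by have := ltn_ord l; rewrite [X in (_ < X)%N]r0.
  by have := rV_in_mul h xM k; rewrite mxE.
have lt_j : (j < size s)%N by lia.
have [g [h gh]] := htpy _ _ lt_ij.
have xE : s`_j *: x = x *m g *m M i.+1 + x *m M i.+2 *m h.
  by have := congr1 (mulmx x) gh; rewrite mulmxDr !mulmxA mul_mx_scalar => <-.
have [||z zP] := IHi j.+1 _ (x *m g); first by lia.
  have -> : x *m g *m M i.+1 = s`_j *: x - x *m M i.+2 *m h by rewrite xE addrK.
  apply: rV_in_sub => k; last exact/sub_ideal_span_takeS/rV_in_mul.
  rewrite mxE; apply: ideal_span_mulr; rewrite (take_nth 0 lt_j).
  have := @ideal_span_nth (rcons (take j s) s`_j) j.
  rewrite size_rcons size_takel ?ltnSn ?(ltnW lt_j) // => /(_ isT).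
  by rewrite nth_rcons size_takel ?(ltnW lt_j) // ltnn eqxx.
have /fin_all_exists[w wP] k := ideal_span_takeS lt_j (zP k).
exists (\row_k w k) => k; apply: reg => //.
suff -> : s`_j * (x - (\row_k w k) *m M i.+1) 0 k =
    ((x *m g - z *m M i - s`_j *: (\row_k w k)) *m M i.+1 + x *m M i.+2 *m h) 0 k.
  apply: rV_in_add => [|l]; last exact: rV_in_mul.
  by apply: rV_in_mul => l; have := wP l; rewrite !mxE.
transitivity ((s`_j *: (x - (\row_k w k) *m M i.+1)) 0 k); first by rewrite [RHS]mxE.
congr (_ 0 k : R); rewrite scalerBr xE !mulmxBl -[z *m _ *m _]mulmxA MM mulmx0 subr0.
by rewrite -scalemxAl addrAC.
Qed.

End IdealSpan.

(** * Consequences of a minimal free resolution *)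

Section MatrixResolution.
Variables (R : comNzRingType) (r : nat -> nat) (D : forall i, 'M[R]_(r i.+1, r i)).
Hypothesis DD : forall i, D i.+1 *m D i = 0.
Hypothesis exactD : forall i (x : 'rV_(r i.+1)),
  x *m D i = 0 -> exists y, x = y *m D i.+1.

Lemma lift_mx i n (X : 'M_(n, r i.+1)) : X *m D i = 0 -> exists Y, X = Y *m D i.+1.
Proof.
move=> XD; have /fin_all_exists[y yP] k : exists y, row k X = y *m D i.+1.
  by apply: exactD; rewrite -row_mul XD row0.
by exists (\matrix_k y k); apply/row_matrixP => k; rewrite row_mul rowK.
Qed.

(** An element of the ideal acts by zero on the quotient, hence by zero up to
    homotopy on its free resolution; the homotopy is lifted step by step. *)
Lemma null_homotopic (c : R) (h0 : 'M_(r 0, r 1)) : h0 *m D 0 = c%:M ->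
  forall i, exists g h, D i *m g + h *m D i.+1 = c%:M.
Proof.
move=> h0D; elim=> [|i [g [h gh]]].
  have [|h hP] := @lift_mx 0 _ (c%:M - D 0 *m h0); last first.
    by exists h0, h; rewrite -hP addrC subrK.
  by rewrite mulmxBl -mulmxA h0D mul_scalar_mx mul_mx_scalar subrr.
have [|h' h'P] := @lift_mx i.+1 _ (c%:M - D i.+1 *m h); last first.
  by exists h, h'; rewrite -h'P addrC subrK.
have hD : h *m D i.+1 = c%:M - D i *m g by rewrite -gh addrAC subrr add0r.
by rewrite mulmxBl -mulmxA hD mulmxBr mulmxA DD mul0mx subr0 mul_scalar_mx mul_mx_scalar subrr.
Qed.

(** The dual complex begins with a zero module, so a regular sequence of length
    [n + 2] in [I] would make the dual complex exact up to its last module and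
    the transpose of [D n] surjective; but [eps] kills the entries of [D n]. *)
Lemma regular_sequence_size_le (I : {pred R}) (S : nzRingType) (eps : {rmorphism R -> S}) n :
    (forall c, c \in I -> exists h0, h0 *m D 0 = c%:M) ->
    map_mx eps (D n) = 0 -> (0 < r n.+1)%N -> r n.+2 = 0%N ->
  forall s : seq R, {subset s <= I} -> regular_sequence s -> (size s <= n.+1)%N.
Proof.
move=> htpyI epsD r_gt0 r0 s sI [_ reg]; rewrite leqNgt; apply/negP => lt_s.
(* The dual complex, shifted by one to start with a zero module. *)
pose r' i := if i is i'.+1 then r i' else 0%N.
pose M i : 'M[R]_(r' i, r' i.+1) := if i is i'.+1 return 'M_(r' i, r' i.+1) then (D i')^T else 0.
have [||||w wP] := @complex_exact_mod _ s r' M reg erefl _ _ n.+1 0 _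
  (delta_mx 0 (Ordinal r_gt0)) _.
- by case=> [|i] /=; rewrite ?mul0mx // -trmx_mul DD trmx0.
- move=> i j lt_ij; have lt_j := leq_ltn_trans (leq_addl i j) lt_ij.
  have [|h0 h0D] := htpyI s`_j; first exact/sI/mem_nth.
  case: i {lt_ij lt_j} => [|i] /=.
    by exists 0, h0^T; rewrite mul0mx add0r -trmx_mul h0D tr_scalar_mx.
  have [g [h gh]] := null_homotopic h0D i; exists g^T, h^T.
  by rewrite -!trmx_mul -linearD gh /= tr_scalar_mx.
- by rewrite addn0.
- by move=> k; exfalso; have := ltn_ord k; rewrite [X in (_ < X)%N]r0.
have := wP (Ordinal r_gt0); rewrite take0 => /ideal_span_nil /(congr1 eps).
rewrite !mxE !eqxx rmorphB rmorph1 rmorph0 rmorph_sum big1 ?subr0 => [/eqP|k _].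
  by rewrite oner_eq0.
rewrite rmorphM mxE; have /matrixP/(_ (Ordinal r_gt0) k) := epsD.
by rewrite !mxE => ->; rewrite mulr0.
Qed.

End MatrixResolution.

(** Writing the entries of [a] through [s] and back gives a product of an
    n x size s and a size s x n matrix which differs from the identity by
    relations among the entries of [a]; after [eps] it is the identity. *)
Lemma generators_size_ge (R S : comNzRingType) (eps : {rmorphism R -> S}) n (a : 'cV[R]_n)
    (I : {pred R}) (s : seq R) :
    (forall c, c \in I <-> exists y : 'rV_n, c%:M = y *m a) ->
    (forall y : 'rV_n, y *m a = 0 -> map_mx eps y = 0) ->
  I =i ideal_span s -> (n <= size s)%N.
Proof.
move=> Ia syz Is.
have /fin_all_exists[B BP] (j : 'I_(size s)) : exists y : 'rV_n, (s`_j)%:M = y *m a.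
  by apply/Ia; rewrite Is ideal_span_nth.
have /fin_all_exists[M MP] (i : 'I_n) :
    exists m : 'I_(size s) -> R, a i 0 = \sum_j m j * s`_j.
  apply/ideal_spanP; rewrite -Is; apply/Ia; exists (delta_mx 0 i).
  by rewrite -rowE; apply/matrixP => k l; rewrite !ord1 !mxE mulr1n.
pose Mm : 'M_(n, size s) := \matrix_(i, j) M i j; pose Bm := \matrix_j B j.
suff : map_mx eps Mm *m map_mx eps Bm = 1%:M by apply: mulmx1_min.
rewrite -map_mxM; apply/eqP; rewrite -(map_mx1 eps) -subr_eq0 -map_mxB.
apply/eqP/row_matrixP => i; rewrite -map_row row0; apply: syz.
rewrite -row_mul mulmxBl mul1mx -mulmxA; apply/matrixP => k l.
have Ba : Bm *m a = \col_j s`_j.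
  apply/row_matrixP => j; rewrite row_mul rowK -BP.
  by apply/matrixP => ? ?; rewrite !ord1 !mxE mulr1n.
rewrite Ba !ord1 !mxE MP; apply/eqP; rewrite subr_eq0; apply/eqP/eq_bigr => j _.
by rewrite !mxE.
Qed.

(** * Comparison with projective resolutions *)

Section Projectives.
Variable R : comNzRingType.

Definition lin_kernel (V W : lmodType R) (f : {linear V -> W}) : {pred V} :=
  fun x => f x == 0.

Lemma lin_kernel_submod (V W : lmodType R) (f : {linear V -> W}) :
  submod_closed (lin_kernel f).
Proof.
split=> [|a x y]; rewrite /lin_kernel !unfold_in ?linear0 // => /eqP fx /eqP fy.
by rewrite linearP fx fy scaler0 addr0.
Qed.

HB.instance Definition _ (V W : lmodType R) (f : {linear V -> W}) :=
  GRing.isSubmodClosed.Build R V (lin_kernel f) (lin_kernel_submod f).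

(** Lifting only asks that the image of [g] be contained in that of [f]: replace
    the target by the quotient of [V] by the kernel of [f]. *)
Lemma projective_lift (P V W : lmodType R) (f : {linear V -> W}) (g : {linear P -> W}) :
    projective P -> (forall p, exists x, f x = g p) ->
  exists h : {linear P -> V}, forall p, f (h p) = g p.
Proof.
move=> projP /boolp.choice[c cP].
pose g' p : quot_module (lin_kernel f) := quot_pi (lin_kernel f) (c p).
have lin_g' : linear g'.
  move=> a p q; rewrite /g' -linearP; apply/eqP; rewrite quot_pi_eq.
  by apply/eqP; rewrite linearB linearP !cP linearP subrr.
pose gl : {linear P -> quot_module (lin_kernel f)} :=
  HB.pack g' (GRing.isLinear.Build R P (quot_module (lin_kernel f)) *:%R g' lin_g').
have [x|h hP] := projP _ _ (@quot_pi R V (lin_kernel f)) gl; first exact: quot_pi_surj.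
exists h => p; have /eqP := hP p; rewrite /= /g' quot_pi_eq => /eqP.
by rewrite linearB cP => /eqP; rewrite subr_eq0 => /eqP.
Qed.

Lemma projective_rV n : projective ('rV[R]_n).
Proof.
move=> V W f g surj_f.
have /fin_all_exists[c cP] (i : 'I_n) : exists x, f x = g (delta_mx 0 i) by apply: surj_f.
pose h (v : 'rV[R]_n) := \sum_i v 0 i *: c i.
have lin_h : linear h.
  move=> a u v; rewrite /h scaler_sumr -big_split; apply: eq_bigr => i _ /=.
  by rewrite !mxE scalerDl scalerA.
pose hl : {linear 'rV[R]_n -> V} :=
  HB.pack h (GRing.isLinear.Build R 'rV[R]_n V *:%R h lin_h).
exists hl => v; rewrite /= /h.
rewrite linear_sum [in RHS](row_sum_delta v) linear_sum; apply: eq_bigr => i _.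
by rewrite !linearZ /= cP.
Qed.

Lemma linear_rV_eps (S : nzRingType) (eps : {rmorphism R -> S}) n p
    (h : {linear 'rV[R]_n -> 'rV[R]_p}) v :
  map_mx eps v = 0 -> map_mx eps (h v) = 0.
Proof.
move=> v0; rewrite (row_sum_delta v) linear_sum; apply/matrixP => i j.
rewrite !mxE summxE rmorph_sum big1 // => k _.
rewrite linearZ mxE rmorphM; have /matrixP/(_ 0 k) := v0.
by rewrite !mxE => ->; rewrite mul0r.
Qed.

(** Compare the free resolution [F] with a projective one [P] in both directions.
    The composite [F -> P -> F] is homotopic to the identity.  If [P] vanishes
    in degree [n + 1], then the homotopy [h] satisfies [h (D n x) = - x] on the
    last module of [F], whereas [eps] kills all entries of [D n]. *)
Lemma resolution_length_ge (Q : lmodType R) (r : nat -> nat)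
    (D : forall i, 'M[R]_(r i.+1, r i)) (aug : {linear 'rV[R]_(r 0) -> Q})
    (S : nzRingType) (eps : {rmorphism R -> S}) n :
    @is_resolution R Q (fun i => 'rV[R]_(r i)) (fun i => mulmxr (D i)) aug ->
    map_mx eps (D n) = 0 -> (0 < r n.+1)%N -> r n.+2 = 0%N ->
  forall k, has_projective_resolution Q k -> (n < k)%N.
Proof.
move=> [augF_surj augF_exact exactF] epsD r_gt0 r0 k.
move=> [P [dP [augP [[augP_surj augP_exact exactP] projP P0]]]].
rewrite ltnNge; apply/negP => le_kn.
have DD i (x : 'rV_(r i.+2)) : x *m D i.+1 *m D i = 0.
  by have [_] := exactF i (x *m D i.+1); apply; exists x.
have dPP i x : dP i (dP i.+1 x) = 0.
  by have [_] := exactP i (dP i.+1 x); apply; exists x.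
(* The three properties are what the next step of each construction needs: al, be
   and the homotopy lift along the differentials. *)
have inv i : exists (al : {linear 'rV[R]_(r i) -> P i}) (be : {linear P i -> 'rV[R]_(r i)})
    (h : {linear 'rV[R]_(r i) -> 'rV[R]_(r i.+1)}),
  [/\ forall x, exists y, dP i y = al (x *m D i),
      forall y, exists x, x *m D i = be (dP i y)
    & forall x, be (al (x *m D i)) - x *m D i = h (x *m D i) *m D i].
  elim: i => [|i [al [be [h [alP beP hP]]]]].
    have [al alP] := projective_rV aug augP_surj.
    have [be beP] := projP 0%N _ _ aug augP augF_surj.
    have [|h hP] := @projective_lift _ _ _ (mulmxr (D 0)) ((be \o al) \- idfun) (@projective_rV _).
      by move=> x; apply/augF_exact; rewrite linearB /= beP alP subrr.
    exists al, be, h; split=> [x|y|x]; last exact/esym/hP.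
      by apply/augP_exact; rewrite alP; apply/augF_exact; exists x.
    by apply/augF_exact; rewrite beP; apply/augP_exact; exists y.
  have [al' al'P] := projective_lift (g := al \o mulmxr (D i)) (@projective_rV _) alP.
  have [be' be'P] := projective_lift (f := mulmxr (D i)) (g := be \o dP i) (projP _) beP.
  have [|h' h'P] := @projective_lift _ _ _ (mulmxr (D i.+1))
    (((be' \o al') \- idfun) \- (h \o mulmxr (D i))) (@projective_rV _).
    move=> x; apply/exactF => /=; rewrite !mulmxBl -hP.
    by have /= -> := be'P (al' x); rewrite al'P subrr.
  exists al', be', h'; split=> [x|y|x].
  - by apply/exactP; rewrite al'P /= DD linear0.
  - by apply/exactF; rewrite be'P /= dPP linear0.
  by have /= -> := h'P (x *m D i.+1); rewrite DD linear0 subr0.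
have [al [be [h [alP _ hP]]]] := inv n.
pose x : 'rV[R]_(r n.+1) := delta_mx 0 (Ordinal r_gt0).
have hx : h (x *m D n) = - x.
  apply/eqP; rewrite -addr_eq0.
  have [|y <-] := (exactF n (h (x *m D n) + x)).1; last first.
    by apply/eqP/matrixP => i j; rewrite !mxE big1 // => l _; have := ltn_ord l;
      rewrite [X in (_ < X)%N]r0.
  rewrite /= mulmxDl -hP; have [y <-] := alP x.
  by rewrite (P0 _ _ y) ?linear0 ?sub0r ?addNr.
have : map_mx eps (h (x *m D n)) = 0.
  by apply: linear_rV_eps; rewrite map_mxM epsD mulmx0.
rewrite hx => /matrixP/(_ 0 (Ordinal r_gt0)); rewrite !mxE !eqxx rmorphN rmorph1.
by move/eqP; rewrite oppr_eq0 oner_eq0.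
Qed.

End Projectives.

(** * Initial ideals and regular sequences of polynomials *)

Section InitialIdeals.
Variables (K : comNzRingType) (n : nat) (w : 'I_n -> nat).
Implicit Types (p q f g x y : {mpoly K[n]}) (a mu : 'X_{1..n}) (d : nat) (e : bool).

Definition mweight a : nat := \sum_i a i * w i.

Lemma mweightD a b : mweight (a + b)%MM = (mweight a + mweight b)%N.
Proof. by rewrite -big_split; apply: eq_bigr => i _; rewrite mnmDE mulnDl. Qed.

Definition weight_lt d p := {in msupp p, forall a, mweight a < d}%N.

Lemma weight_lt_coef d p a : weight_lt d p -> (d <= mweight a)%N -> p@_a = 0.
Proof.
move=> pd da; apply: memN_msupp_eq0; apply/negP => /pd.
by rewrite ltnNge da.
Qed.

Lemma weight_ltW d d' p : (d <= d')%N -> weight_lt d p -> weight_lt d' p.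
Proof. by move=> de pd a /pd /leq_trans; apply. Qed.

Lemma weight_lt0 d : weight_lt d 0.
Proof. by move=> a; rewrite msupp0. Qed.

Lemma weight_ltD d p q : weight_lt d p -> weight_lt d q -> weight_lt d (p + q).
Proof. by move=> pd qd a /msuppD_le; rewrite mem_cat => /orP[/pd|/qd]. Qed.

Lemma weight_ltZ d c p : weight_lt d p -> weight_lt d (c *: p).
Proof. by move=> pd a /msuppZ_le /pd. Qed.

Lemma weight_ltN d p : weight_lt d p -> weight_lt d (- p).
Proof. by move=> pd; rewrite -scaleN1r; apply: weight_ltZ. Qed.

Lemma weight_lt_sum d (I : eqType) (s : seq I) (P : pred I) (F : I -> {mpoly K[n]}) :
  (forall i, i \in s -> P i -> weight_lt d (F i)) -> weight_lt d (\sum_(i <- s | P i) F i).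
Proof.
move=> Fd; rewrite big_seq_cond.
apply: big_ind => [|p q|i /andP[]]; [exact: weight_lt0 | exact: weight_ltD | exact: Fd].
Qed.

Lemma weight_ltM d d' p q : weight_lt d p -> weight_lt d'.+1 q -> weight_lt (d + d') (p * q).
Proof.
move=> pd qe a /msuppM_le /allpairsP[[b c] /= [/pd bd /qe ce ->]].
by rewrite mweightD -addSn leq_add.
Qed.

Lemma weight_ltX a : weight_lt (mweight a).+1 'X_[a].
Proof. by move=> b /mem_msuppXP <-. Qed.

Lemma weight_lt_eq0 p : weight_lt 0 p -> p = 0.
Proof.
rewrite /weight_lt => p0; apply: msuppnil0; case: (msupp p) p0 => // a s p0.
by have := p0 a (mem_head _ _).
Qed.

Lemma exists_weight_lt p : exists d, weight_lt d p.
Proof.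
exists (\max_(a <- msupp p) mweight a).+1 => a ap.
by rewrite ltnS (leq_bigmax_seq a).
Qed.

Definition top_monomial p a := a \in msupp p /\ weight_lt (mweight a).+1 p.

Lemma exists_top_monomial p : p != 0 -> exists a, top_monomial p a.
Proof.
rewrite -msupp_eq0 /top_monomial /weight_lt; elim: (msupp p) => // a s IHs _.
have [-> | /IHs[b [bs sb]]] := eqVneq s [::].
  by exists a; split=> [|c]; rewrite ?mem_seq1 ?inE // => /eqP ->.
have [ab | ba] := leqP (mweight a) (mweight b).
  exists b; rewrite inE bs orbT; split=> // c.
  by rewrite inE => /predU1P[-> // | /sb].
exists a; rewrite mem_head; split=> // c; rewrite inE => /predU1P[-> // | /sb].
by rewrite !ltnS => /leq_trans -> //; apply: ltnW.
Qed.

(** The initial form of [f] is plus or minus the monomial [mu], the sign being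
    given by [e]. *)
Definition leads f (e : bool) mu := weight_lt (mweight mu) (f - (-1) ^+ e *: 'X_[mu]).

Lemma mweightU i : mweight U_(i) = w i.
Proof.
rewrite /mweight (bigD1 i) //= mnm1E eqxx mul1n big1 ?addn0 // => j.
by rewrite mnm1E eq_sym => /negPf ->.
Qed.

Lemma leadsD f g e mu :
  leads f e mu -> weight_lt (mweight mu) g -> leads (f + g) e mu.
Proof. by move=> lf lg; rewrite /leads addrAC; apply: weight_ltD. Qed.

Lemma mul_sign_scale b f : (-1) ^+ b * f = (-1) ^+ b *: f.
Proof. by rewrite -mul_mpolyC rmorphXn rmorphN rmorph1. Qed.

Lemma leads_sign f e mu b : leads f e mu -> leads ((-1) ^+ b * f) (odd b (+) e) mu.
Proof.
move=> lf; rewrite /leads mul_sign_scale signr_addb signr_odd -scalerA -scalerBr.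
exact: weight_ltZ.
Qed.

Lemma leads_mulX f e mu i : leads f e mu -> leads ('X_i * f) e (U_(i) + mu)%MM.
Proof.
move=> lf; rewrite /leads mpolyXD scalerAr -mulrBr mweightD addnC mulrC.
by apply: weight_ltM; [exact: lf | exact: weight_ltX].
Qed.

Lemma weight_lt_sign d b f : weight_lt d f -> weight_lt d ((-1) ^+ b * f).
Proof. by rewrite mul_sign_scale; apply: weight_ltZ. Qed.

(** The monomials satisfying [L] are those of the initial ideal of the ideal
    spanned by [s]: each of them is the initial form of some element, and the
    monomials of top weight of an element satisfy [L]. *)
Definition initial_ideal (s : seq {mpoly K[n]}) (L : pred 'X_{1..n}) : Prop :=
  (forall a, L a -> exists2 g, g \in ideal_span s & leads g false a) /\
  (forall g a, g \in ideal_span s -> top_monomial g a -> L a).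

Lemma initial_ideal_nil : initial_ideal [::] pred0.
Proof.
by split=> // g a /ideal_span_nil ->; rewrite /top_monomial msupp0 => -[].
Qed.

(** Monomials in the initial ideal are traded for monomials of smaller weight, so
    the process ends. *)
Lemma division s (L : pred 'X_{1..n}) f : initial_ideal s L ->
  exists2 x, f - x \in ideal_span s & {in msupp x, forall a, ~~ L a}.
Proof.
case=> reduce _; have [d] := exists_weight_lt f.
elim: d f => [|d IHd] f fd.
  by exists 0; rewrite ?subr0 ?(weight_lt_eq0 fd) ?ideal_span0 // => a; rewrite msupp0.
rewrite [f]mpolyE big_seq.
pose good g := exists2 x, g - x \in ideal_span s & {in msupp x, forall a, ~~ L a}.
apply: (big_ind good) => [|p q [x px xL] [y qy yL]|a /fd].
- by exists 0; rewrite ?subr0 ?ideal_span0 // => a; rewrite msupp0.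
- exists (x + y); first by rewrite opprD addrACA ideal_span_add.
  by move=> a /msuppD_le; rewrite mem_cat => /orP[/xL|/yL].
rewrite ltnS => ad; suff [x px xL] : good 'X_[a].
  exists (f@_a *: x); last by move=> b /msuppZ_le/xL.
  by rewrite -scalerBr -mul_mpolyC ideal_span_mull.
have [La | nLa] := boolP (L a); last first.
  by exists 'X_[a]; rewrite ?subrr ?ideal_span0 // => b /mem_msuppXP <-.
have [g gs /(weight_ltW ad)] := reduce a La; rewrite expr0 scale1r => /weight_ltN.
rewrite opprB => /IHd[x xs xL]; exists x => //.
by rewrite -(subrK g 'X_[a]) addrAC ideal_span_add.
Qed.

Lemma lead_mul_coef f e mu x a : leads f e mu -> weight_lt (mweight a).+1 x ->
  (f * x)@_(mu + a) = (-1) ^+ e * x@_a.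
Proof.
move=> fmu xa; rewrite -(subrK ((-1) ^+ e *: 'X_[mu]) f) mulrDl mcoeffD.
rewrite (weight_lt_coef (weight_ltM fmu xa)) ?mweightD // add0r.
by rewrite -scalerAl mcoeffZ ['X_[_] * x]mulrC mcoeffMX.
Qed.

Lemma lead_mul_weight f e mu x d : leads f e mu -> weight_lt d.+1 x ->
  weight_lt (mweight mu + d).+1 (f * x).
Proof.
move=> fmu xd; rewrite -(subrK ((-1) ^+ e *: 'X_[mu]) f) mulrDl.
apply: weight_ltD; first exact/(weight_ltW (leqnSn _))/weight_ltM.
rewrite -scalerAl; apply: weight_ltZ; rewrite -addSn.
by apply: weight_ltM => //; apply: weight_ltX.
Qed.

Lemma lead_mul_top f e mu x d b : leads f e mu -> weight_lt d.+1 x ->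
  b \in msupp (f * x) -> mweight b = (mweight mu + d)%N -> (mu <= b)%MM.
Proof.
move=> fmu xd; rewrite -(subrK ((-1) ^+ e *: 'X_[mu]) f) mulrDl => bf wb.
have : b \in msupp ('X_[mu] * x).
  move: bf; rewrite !mcoeff_msupp mcoeffD (weight_lt_coef (weight_ltM fmu xd)) ?wb // add0r.
  by rewrite -scalerAl mcoeffZ; apply: contraNneq => ->; rewrite mulr0.
by case/msuppM_le/allpairsP => -[c1 c2] /= [/mem_msuppXP <- _ ->]; apply: lem_addr.
Qed.

(** The factor of [f] may be taken reduced modulo [s].  By coprimality its
    product with [f] then has top monomials outside [L], which no element of the
    ideal of [s] can have or cancel.  This gives both the regularity of [f] and
    the initial ideal of the larger ideal. *)
Lemma initial_ideal_step s L f e mu : initial_ideal s L -> leads f e mu ->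
    (forall a, L (mu + a)%MM -> L a) ->
  (forall x, f * x \in ideal_span s -> x \in ideal_span s) /\
  initial_ideal (rcons s f) (fun a => L a || (mu <= a)%MM).
Proof.
move=> initL fmu coprimeL; have [reduce topL] := initL.
have sub_s : {subset ideal_span s <= ideal_span (rcons s f)}.
  apply: ideal_span_min => i lt_i; have := @ideal_span_nth _ (rcons s f) i.
  by rewrite size_rcons nth_rcons lt_i; apply; apply: ltnW.
have f_s : f \in ideal_span (rcons s f).
  have := @ideal_span_nth _ (rcons s f) (size s).
  by rewrite size_rcons nth_rcons ltnn eqxx; apply.
have topM x a : {in msupp x, forall a, ~~ L a} -> top_monomial x a ->
    (f * x)@_(mu + a) != 0 /\ ~~ L (mu + a)%MM.
  move=> xL [ax xa]; split; last by apply: contra (xL a ax); apply: coprimeL.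
  rewrite (lead_mul_coef fmu xa); move: ax; rewrite mcoeff_msupp.
  by case: (e); rewrite ?expr0 ?mul1r // expr1 mulN1r oppr_eq0.
split=> [x fx | ].
  have [y xy yL] := division x initL.
  have fy : f * y \in ideal_span s.
    rewrite -[y](subKr x) mulrBr; apply: ideal_span_sub => //.
    exact: ideal_span_mull.
  have [y0 | /exists_top_monomial[a ya]] := eqVneq y 0; first by rewrite -[x]subr0 -y0.
  have [fya /negP[]] := topM y a yL ya; apply: topL fy _.
  rewrite /top_monomial mcoeff_msupp fya mweightD; split=> //.
  by apply: lead_mul_weight fmu _; case: ya.
split=> [a /orP[/reduce[g /sub_s] | mua] | g b /ideal_span_rcons[x0 gx0] [bg gb]].
- by exists g.
- have [c aE] : exists c, a = (mu + c)%MM by exists (a - mu)%MM; rewrite addmC submK.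
  exists ((-1) ^+ e *: f * 'X_[c]).
    by rewrite -scalerAl -mul_mpolyC; apply/ideal_span_mull/ideal_span_mulr.
  rewrite /leads expr0 scale1r aE mweightD mpolyXD.
  (* The sign makes the leading coefficient of the multiple of f equal to 1. *)
  have -> : (-1) ^+ e *: f * 'X_[c] - 'X_[mu] * 'X_[c] =
     ((-1) ^+ e *: (f - (-1) ^+ e *: 'X_[mu])) * 'X_[c].
    by rewrite scalerBr mulrBl scalerA -signr_addb addbb scale1r.
  by apply: weight_ltM; [apply: weight_ltZ | apply: weight_ltX].
have [x xx0 xL] := division x0 initL; set y := g - f * x.
have ys : y \in ideal_span s.
  rewrite /y -[x](subKr x0) mulrBr opprB addrCA addrC ideal_span_add //.
  exact: ideal_span_mull.
have gE : g = y + f * x by rewrite subrK.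
have [x_0 | /exists_top_monomial[a xa]] := eqVneq x 0.
  by apply/orP; left; apply: topL (b) ys _; rewrite /y x_0 mulr0 subr0.
have [fxa nLa] := topM x a xL xa.
have fx_wt : weight_lt (mweight mu + mweight a).+1 (f * x).
  by apply: lead_mul_weight fmu _; case: xa.
have [le_ab | lt_ba] := leqP (mweight (mu + a)%MM) (mweight b).
  have y_wt : weight_lt (mweight b).+1 y.
    apply: weight_ltD => //; apply/weight_ltN/weight_ltW/fx_wt.
    by rewrite -mweightD.
  have [by_ | nby] := boolP (b \in msupp y); first by rewrite (topL y).
  have bfx : b \in msupp (f * x).
    by move: bg; rewrite gE => /msuppD_le; rewrite mem_cat (negPf nby).
  apply/orP; right; apply: (lead_mul_top fmu xa.2 bfx).
  by apply/eqP; rewrite eqn_leq -{2}mweightD le_ab andbT -ltnS fx_wt.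
(* Here the top monomial of f x has to cancel against one of y, which lies in L. *)
case/negP: nLa; apply: topL ys _.
have ya : y@_(mu + a) = - (f * x)@_(mu + a).
  by rewrite mcoeffB (weight_lt_coef gb) ?sub0r.
rewrite /top_monomial mcoeff_msupp ya oppr_eq0 fxa mweightD; split=> //.
apply: weight_ltD; last exact: weight_ltN.
by apply: weight_ltW gb; rewrite ltnS -mweightD ltnW.
Qed.

End InitialIdeals.

(** * Leading terms of Pfaffians *)

Section PfaffianLeadingTerm.
Variables (K : comNzRingType) (n N : nat) (w : 'I_n -> nat).
Variables (A : 'M[{mpoly K[n]}]_N) (c : 'I_N -> 'I_N -> 'I_n).
Hypothesis A_var : forall i j : 'I_N, (i < j)%N -> A i j = 'X_(c i j).
Hypothesis w_var : forall i j : 'I_N, (i < j)%N -> w (c i j) = (N ^ (N - i.+1) * j)%N.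

(** The weights [N ^ (N - i.+1) * j] are built as digits in base [N], so the edge
    of the least index dominates all the other edges together. *)
Lemma Pf_weight_lt (S : {set 'I_N}) a :
  {in S, forall i : 'I_N, (a <= i)%N} -> weight_lt w (N ^ (N - a)) (Pf A S).
Proof.
elim/set_ind_min: S a => [a _ | S b bS min_b IHS a min_a].
  rewrite Pf_set0 -mpolyX0 => _ /mem_msuppXP <-.
  rewrite /mweight big1 => [|i _]; last by rewrite mnm0E.
  by rewrite expn_gt0; case: (N).
have lt_bN := ltn_ord b; rewrite (Pf_min_expand A bS min_b).
apply: weight_lt_sum => x _; rewrite !inE => /andP[xb xS].
have lt_bx : (b < x)%N by rewrite ltn_neqAle min_b // andbT (inj_eq val_inj) eq_sym.
rewrite A_var // -mulrA; apply: weight_lt_sign; rewrite mulrC.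
have := @weight_ltM _ _ w (N ^ (N - b.+1)) (w (c b x)) (Pf A (S :\ b :\ x)) 'X_(c b x).
move/(_ _ _)/(weight_ltW _); apply.
- rewrite w_var // -mulnS; apply: (@leq_trans (N ^ (N - b.+1) * N)).
    by rewrite leq_mul2l ltn_ord orbT.
  rewrite -expnSr; apply: leq_pexp2l; first exact: leq_trans lt_bN.
  by have := min_a b bS; lia.
- apply: IHS; first exact: card_setD2_lt.
  move=> i; rewrite !inE => /and3P[_ ib iS].
  by rewrite ltn_neqAle min_b // andbT (inj_eq val_inj) eq_sym.
by rewrite -mweightU; apply: weight_ltX.
Qed.

(** By the choice of weights, the heaviest term pairs the least index with the
    largest one, and so on inwards.  If [S] is stable under the reflection
    [i |-> sg - i] without fixed point, this pairs each index with its
    reflection. *)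
Lemma Pf_leads (sg : nat) (S : {set 'I_N}) :
    {in S, forall i : 'I_N, exists2 j, j \in S & (i != j) && (i + j == sg)%N} ->
  exists e mu, leads w (Pf A S) e mu /\
    (forall v, mu v != 0%N -> exists i j : 'I_N, [/\ (i < j)%N, (i + j = sg)%N & v = c i j]).
Proof.
elim/set_ind_min: S => [_ | S a aS min_a IHS refl_S].
  exists false, 0%MM; split=> [|v]; last by rewrite mnm0E.
  by rewrite /leads Pf_set0 mpolyX0 expr0 scale1r subrr; apply: weight_lt0.
have [z zS /andP[az /eqP az_sg]] := refl_S a aS.
have max_z : {in S, forall x : 'I_N, (x <= z)%N}.
  by move=> x xS; have [y /min_a ay /andP[_ /eqP xy]] := refl_S x xS; lia.
have lt_az : (a < z)%N by rewrite ltn_neqAle min_a // andbT (inj_eq val_inj).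
have [|e [mu [lead_e mu_v]]] := IHS _ (card_setD2_lt z aS).
  move=> i; rewrite !inE => /and3P[iz ia iS].
  have [j jS /andP[ij /eqP ij_sg]] := refl_S i iS; exists j; last by rewrite ij ij_sg eqxx.
  rewrite !inE jS andbT; apply/andP; split.
    by apply: contraNneq ia => jz; apply/eqP/val_inj; move: ij_sg; rewrite jz /=; lia.
  by apply: contraNneq iz => ja; apply/eqP/val_inj; move: ij_sg; rewrite ja /=; lia.
exists (odd (above S z) (+) e), (U_(c a z) + mu)%MM; split; last first.
  move=> v; rewrite mnmDE mnm1E; case: (eqVneq (c a z) v) => [<- _ | _ /mu_v //].
  by exists a, z; split.
have za : z != a by rewrite eq_sym.
rewrite (Pf_min_expand A aS min_a) (bigD1 z) /=; last by rewrite !inE za.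
apply: leadsD; first by rewrite -mulrA; apply: leads_sign; rewrite A_var //; apply: leads_mulX.
apply: weight_lt_sum => b _; rewrite !inE -andbA => /and3P[ba bS bz].
have lt_ab : (a < b)%N by rewrite ltn_neqAle min_a // andbT (inj_eq val_inj) eq_sym.
have lt_bz : (b < z)%N by rewrite ltn_neqAle max_z // andbT (inj_eq val_inj).
rewrite A_var // -mulrA; apply: weight_lt_sign; rewrite mulrC.
have := @weight_ltM _ _ w (N ^ (N - a.+1)) (w (c a b)) (Pf A (S :\ a :\ b)) 'X_(c a b).
move/(_ _ _)/(weight_ltW _); apply.
- rewrite mweightD mweightU !w_var // -mulnS; apply: leq_trans (leq_addr _ _).
  by rewrite leq_mul2l lt_bz orbT.
- apply: Pf_weight_lt => i; rewrite !inE => /and3P[_ ia iS].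
  by rewrite ltn_neqAle min_a // andbT (inj_eq val_inj) eq_sym.
by rewrite -mweightU; apply: weight_ltX.
Qed.

End PfaffianLeadingTerm.

Section GenericLeadingTerms.
Variable m : nat.
Local Notation N := (2 * m + 1)%N.
Local Notation n := #|vars m|.

Definition generic_U : 'M[{mpoly int[n]}]_(3, N) := \matrix_(k, i) var (inr (k, i)).

(** The index of the column whose variable occurs in the leading term of the
    [k]-th linear generator: the first, the middle and the last one. *)
Definition lead_col (k : 'I_3) : nat := (k * m)%N.

(** The heavy variables [u_ki] outweigh all Pfaffians, so that they decide first
    which term of the linear generator leads. *)
Definition var_weight (v : vars m) : nat :=
  match v with
  | inl p => (N ^ (N - (val p).1.+1) * (val p).2)%N
  | inr (k, i) => if i == lead_col k :> nat then (N ^ N)%N else 0%N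
  end.

Definition gen_weight (i : 'I_n) : nat := var_weight (enum_val i).

Definition c_var (i j : 'I_N) : 'I_n :=
  if insub (i, j) is Some p then enum_rank (inl p : vars m)
  else enum_rank (inr (k1, i) : vars m).

Lemma generic_skew_lt (i j : 'I_N) : (i < j)%N -> generic_skew m i j = 'X_(c_var i j).
Proof. by move=> ij; rewrite mxE /c_var; case: insubP => [p|] //=; rewrite ij. Qed.

Lemma c_varE (i j : 'I_N) : (i < j)%N ->
  exists2 p, val p = (i, j) & c_var i j = enum_rank (inl p : vars m).
Proof. by move=> ij; rewrite /c_var; case: insubP => [p _ pE|]; [exists p | rewrite /= ij]. Qed.

Lemma gen_weight_c_var (i j : 'I_N) : (i < j)%N ->
  gen_weight (c_var i j) = (N ^ (N - i.+1) * j)%N.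
Proof. by case/c_varE => p pE ->; rewrite /gen_weight enum_rankK /= pE. Qed.

Lemma generic_skewE (i j : 'I_N) : generic_skew m i j = - generic_skew m j i.
Proof.
rewrite !mxE; case: insubP => [p lt_ij _|le_ij].
  by rewrite insubF ?opprK //= ltnNge ltnW.
case: insubP => [p lt_ji _|le_ji]; first by rewrite ?opprK.
by rewrite oppr0.
Qed.

Lemma generic_skew_diag (i : 'I_N) : generic_skew m i i = 0.
Proof. by rewrite mxE insubF //= ltnn. Qed.

Local Notation lin := (@lin_gen _ N m (generic_skew m) generic_U).

Lemma pf_vec_PfE (i : 'I_N) :
  pf_vec m (generic_skew m) i = (-1) ^+ above [set: 'I_N] i * Pf (generic_skew m) (setT :\ i).
Proof.
rewrite /pf_vec ffunE in_setT /divpow ext_divpowE ffunE ifT //; apply/andP; split.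
  rewrite -(eqn_add2l 1); have := cardsD1 i [set: 'I_N].
  by rewrite in_setT cardsT card_ord => <-; rewrite addnC.
by apply/forall_inP.
Qed.

(** [mu] involves only the [c_ij] with [i + j = 2 * m + 1 - k] and the [u_ki];
    these sets of variables are disjoint for different [k]. *)
Definition supported_on (k : 'I_3) (mu : 'X_{1..n}) := forall v, mu v != 0%N ->
  match enum_val v with
  | inl p => ((val p).1 + (val p).2 + k = 2 * m + 1)%N
  | inr q => q.1 = k
  end.

Lemma supported_on_coprime k l mu nu (a : 'X_{1..n}) :
    supported_on k mu -> supported_on l nu -> k != l ->
  (mu <= nu + a)%MM -> (mu <= a)%MM.
Proof.
move=> mu_v nu_v kl /mnm_lepP le_mu; apply/mnm_lepP => v.
have := le_mu v; rewrite mnmDE; have [-> // | /mu_v] := eqVneq (mu v) 0%N.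
have [-> // | /nu_v] := eqVneq (nu v) 0%N; case: (enum_val v) => [p Ek El|q -> lk].
  by case/eqP: kl; apply: val_inj => /=; lia.
by rewrite lk eqxx in kl.
Qed.

(** Without the index [k * m], the indices up to [2 * m] are stable under the
    reflection [i |-> 2 * m + 1 - k - i] and no index is fixed. *)
Lemma lin_gen_leads k :
  exists e mu, leads gen_weight (lin k) e mu /\ supported_on k mu.
Proof.
have lt_k : (k * m < N)%N by rewrite addn1 ltnS leq_mul2r -ltnS ltn_ord orbT.
pose ik := Ordinal lt_k.
have [|e [mu [lead_e mu_v]]] :=
  @Pf_leads _ _ _ gen_weight _ c_var generic_skew_lt gen_weight_c_var (2 * m + 1 - k)%N
    (setT :\ ik).
  have kE : [\/ k = 0%N :> nat, k = 1%N :> nat | k = 2%N :> nat].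
    by elim/ord3_ind: (k); [constructor 1 | constructor 2 | constructor 3].
  move=> i; rewrite !inE andbT -(inj_eq val_inj) /= => i_k.
  have lt_i := ltn_ord i.
  have lt_j : (2 * m + 1 - k - i < N)%N by case: kE i_k => ->; lia.
  exists (Ordinal lt_j); rewrite ?inE ?andbT -(inj_eq val_inj) /=.
    by case: kE i_k => ->; lia.
  by case: kE i_k => ->; lia.
exists (odd (above [set: 'I_N] ik) (+) e), (U_(enum_rank (inr (k, ik) : vars m)) + mu)%MM.
split; last first.
  move=> v; rewrite mnmDE mnm1E.
  case: (eqVneq _ v) => [<- _ | _ /mu_v]; first by rewrite enum_rankK.
  case=> i [j [lt_ij ij ->]]; have [p pE ->] := c_varE lt_ij; rewrite enum_rankK pE /=.
  by have := ltn_ord k; lia.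
rewrite /lin_gen pf_linE (bigD1 ik) //=; apply: leadsD.
  rewrite pf_vec_PfE mulrCA mxE; apply: leads_sign; exact: leads_mulX.
apply: weight_lt_sum => i _ i_k; rewrite pf_vec_PfE mulrCA; apply: weight_lt_sign.
rewrite mxE mulrC mweightD mweightU /gen_weight enum_rankK /= eqxx.
apply: (@weight_ltW _ _ _ (N ^ (N - 0) + 0)); first by rewrite subn0 addn0 leq_addr.
apply: weight_ltM.
  by apply: (@Pf_weight_lt _ _ _ gen_weight _ c_var) => //;
    [exact: generic_skew_lt | exact: gen_weight_c_var].
apply: (weight_ltW _ (@weight_ltX _ _ gen_weight _)).
rewrite mweightU /gen_weight enum_rankK /= ifF //.
by apply/negbTE; move: i_k; rewrite -(inj_eq val_inj).
Qed.

Lemma lin_gens_regular : weakly_regular [:: lin k1; lin k2; lin k3].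
Proof.
have [e1 [mu1 [l1 v1]]] := lin_gen_leads k1.
have [e2 [mu2 [l2 v2]]] := lin_gen_leads k2.
have [e3 [mu3 [l3 v3]]] := lin_gen_leads k3.
have [|reg1 init1] := initial_ideal_step (initial_ideal_nil _ gen_weight) l1; first by [].
have [|reg2 init2] := initial_ideal_step init1 l2.
  by move=> a; apply: supported_on_coprime v1 v2 _.
have [|reg3 _] := initial_ideal_step init2 l3.
  move=> a /orP[] /= /supported_on_coprime le_a; apply/orP; [left | right].
    exact: le_a v1 v3 _.
  exact: le_a v2 v3 _.
by case=> [|[|[|//]]] _ x /=; [exact: reg1 | exact: reg2 | exact: reg3].
Qed.

End GenericLeadingTerms.

(** * Bidegrees *)

Section Bidegrees.
Variable m : nat.
Local Notation N := (2 * m + 1)%N.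
Local Notation n := #|vars m|.
Implicit Types (p q : polyA m) (d e : int * int).

Lemma bidegD (a b : 'X_{1..n}) : bideg (a + b)%MM = bideg a + bideg b.
Proof.
rewrite /bideg; congr pair; rewrite -big_split; apply: eq_bigr => -[x|x] _ //=;
  by rewrite mnmDE PoszD.
Qed.

Lemma bideg0 : bideg (0%MM : 'X_{1..n}) = 0.
Proof. by rewrite /bideg; congr pair; apply: big1 => -[x|x] _ //; rewrite mnm0E. Qed.

Lemma bihomog0 d : bihomogeneous d (0 : polyA m).
Proof. by rewrite /bihomogeneous msupp0. Qed.

Lemma bihomogD d p q : bihomogeneous d p -> bihomogeneous d q -> bihomogeneous d (p + q).
Proof.
move=> /allP hp /allP hq; apply/allP => a /msuppD_le.
by rewrite mem_cat => /orP[/hp | /hq].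
Qed.

Lemma bihomogN d p : bihomogeneous d p -> bihomogeneous d (- p).
Proof. by move=> /allP hp; apply/allP => a; rewrite (perm_mem (msuppN p)) => /hp. Qed.

Lemma bihomog_sum d (I : Type) (s : seq I) (P : pred I) (F : I -> polyA m) :
  (forall i, P i -> bihomogeneous d (F i)) -> bihomogeneous d (\sum_(i <- s | P i) F i).
Proof.
move=> hF; apply: (big_ind (fun p => bihomogeneous d p)) => //; first exact: bihomog0.
by move=> p q; apply: bihomogD.
Qed.

Lemma bihomogM d e p q : bihomogeneous d p -> bihomogeneous e q ->
  bihomogeneous (d + e) (p * q).
Proof.
move=> /allP hp /allP hq; apply/allP => a /msuppM_le /allpairsP[[b c] /= [bp cq ->]].
by rewrite bidegD (eqP (hp b bp)) (eqP (hq c cq)).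
Qed.

Lemma bihomog1 : bihomogeneous 0 (1 : polyA m).
Proof. by apply/allP => a; rewrite msupp1 inE => /eqP ->; rewrite bideg0. Qed.

Lemma bihomog_sign d k p : bihomogeneous d p -> bihomogeneous d ((-1) ^+ k * p).
Proof.
by elim: k => [|k IHk] hp; rewrite ?mul1r // exprS mulN1r mulNr bihomogN ?IHk.
Qed.

(** This reduces the minimality of the resolution to its bidegrees. *)
Lemma bihomog_const d p : bihomogeneous d p -> d != 0 -> p@_0%MM = 0.
Proof.
move=> /allP hp d0; apply/eqP; rewrite mcoeff_eq0; apply: contra d0 => /hp.
by rewrite bideg0 eq_sym.
Qed.

Lemma bihomog_var (v : vars m) :
  bihomogeneous (if v is inl _ then (1, 0) else (0, 1)) (var v).
Proof.
case: v => v; apply/allP => a /mem_msuppXP <-; rewrite /bideg; apply/eqP; congr pair.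
- rewrite (bigD1 (inl v)) //= mnm1E eqxx big1 // => -[x|x] //.
  by rewrite mnm1E (inj_eq enum_rank_inj) eq_sym => /negPf ->.
- by apply: big1 => -[x|x] _ //; rewrite mnm1E (inj_eq enum_rank_inj).
- by apply: big1 => -[x|x] _ //; rewrite mnm1E (inj_eq enum_rank_inj).
rewrite (bigD1 (inr v)) //= mnm1E eqxx big1 // => -[x|x] //.
by rewrite mnm1E (inj_eq enum_rank_inj) eq_sym => /negPf ->.
Qed.

Lemma bihomog_skew i j : bihomogeneous (1, 0) (generic_skew m i j).
Proof.
rewrite mxE; case: insubP => [p _ _|_]; first exact: (bihomog_var (inl p)).
case: insubP => [p _ _|_]; last exact: bihomog0.
exact/bihomogN/(bihomog_var (inl p)).
Qed.

Lemma bihomog_Pf k (S : {set 'I_N}) : #|S| = (2 * k)%N ->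
  bihomogeneous (Posz k, 0) (Pf (generic_skew m) S).
Proof.
elim/set_ind_min: S k => [k | S a aS min_a IHS k cS].
  by rewrite cards0 => k0; rewrite Pf_set0 (_ : k = 0%N) ?bihomog1 //; lia.
rewrite (Pf_min_expand _ aS min_a); apply: bihomog_sum => b; rewrite !inE => /andP[ba bS].
rewrite -mulrA; apply: bihomog_sign.
have cSab : #|S| = #|S :\ a :\ b|.+2.
  by rewrite (cardsD1 a) aS (cardsD1 b (S :\ a)) !inE ba bS.
have kE : k = k.-1.+1 by move: cS; rewrite cSab; lia.
have -> : (Posz k, 0) = (1, 0) + (Posz k.-1, 0) :> (int * int)%type.
  by congr pair; rewrite {1}kE intS.
apply: bihomogM; first exact: bihomog_skew.
apply: IHS; first exact: card_setD2_lt.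
by move: cS; rewrite cSab {1}kE mulnS => -[].
Qed.

Lemma bihomog_divpow k (S : {set 'I_N}) :
  bihomogeneous (Posz k, 0) (divpow (generic_skew m) k S).
Proof.
rewrite /divpow ext_divpowE ffunE; case: ifP => [/andP[/eqP cS _]|_].
  exact: bihomog_Pf.
exact: bihomog0.
Qed.

Lemma bihomog_vwedge d e (x : 'I_N -> polyA m) (E : {ffun {set 'I_N} -> (polyA m)^o}) :
    (forall i, bihomogeneous d (x i)) -> (forall S, bihomogeneous e (E S)) ->
  forall S, bihomogeneous (d + e) (vwedge x E S : polyA m).
Proof.
move=> hx hE S; rewrite sum_ffunE; apply: bihomog_sum => i _; rewrite !ffunE.
apply: bihomogM; first exact: hx.
by case: ifP => _; [apply: bihomog_sign | apply: bihomog0].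
Qed.

Lemma bihomog_pf_tri d1 d2 d3 (x y z : 'I_N -> polyA m) :
    (forall i, bihomogeneous d1 (x i)) -> (forall i, bihomogeneous d2 (y i)) ->
    (forall i, bihomogeneous d3 (z i)) ->
  bihomogeneous (d3 + (d2 + (d1 + (Posz (m - 1), 0)))) (pf_tri m (generic_skew m) x y z).
Proof. by move=> hx hy hz; do 3!apply: bihomog_vwedge => //; apply: bihomog_divpow. Qed.

Lemma bihomog_pf_lin d (x : 'I_N -> polyA m) : (forall i, bihomogeneous d (x i)) ->
  bihomogeneous (d + (Posz m, 0)) (pf_lin m (generic_skew m) x).
Proof. by move=> hx; apply: bihomog_vwedge => //; apply: bihomog_divpow. Qed.

Lemma bihomog_delta i j : bihomogeneous 0 ((j == i :> 'I_N)%:R : polyA m).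
Proof. by case: eqP => _; [exact: bihomog1 | exact: bihomog0]. Qed.

Lemma bihomog_U k i : bihomogeneous (0, 1) (generic_U m k i : polyA m).
Proof. by rewrite mxE; exact: (bihomog_var (inr (k, i))). Qed.

End Bidegrees.

(** * The resolution of the ideal *)

Section Resolution.
Variable m : nat.
Hypothesis m_gt0 : (0 < m)%N.
Local Notation N := (2 * m + 1)%N.
Local Notation R := (polyA m).
Local Notation A := (generic_skew m).
Local Notation U := (generic_U m : 'M[R]_(3, N)).
Local Notation eps := (@mcoeff #|vars m| int 0%MM).

Definition res_rank (i : nat) : nat :=
  match i with 0 => 1 | 1 => 1 + 3 | 2 => N + 3 | 3 => N | _ => 0 end%N.

Definition res_mx (i : nat) : 'M[R]_(res_rank i.+1, res_rank i) :=
  match i return 'M[R]_(res_rank i.+1, res_rank i) with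
  | 0 => res_d0 m A U
  | 1 => res_d1 m A U
  | 2 => res_d2 A U
  | _ => 0
  end.

Definition res_deg (i : nat) : 'I_(res_rank i) -> int * int :=
  match i return 'I_(res_rank i) -> int * int with
  | 0 => fun _ => (0, 0)
  | 1 => fun k : 'I_(1 + 3) =>
      if split k is inl _ then (Posz (m - 1), 3) else (Posz m, 1)
  | 2 => fun k : 'I_(N + 3) =>
      if split k is inl _ then (Posz (2 * m - 1), 3) else (Posz (2 * m), 2)
  | 3 => fun _ => (Posz (2 * m), 3)
  | _ => fun _ => (0, 0)
  end.

Let skewA : forall i j : 'I_N, A i j = - A j i := @generic_skewE m.
Let diagA : forall i : 'I_N, A i i = 0 := @generic_skew_diag m.
Let T := tri_gen m A U.
Let a := lin_gen m A U.

Lemma ideal_gensE : ideal_gens m = [:: T; a k1; a k2; a k3].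
Proof.
have uE k : u_ m k = ext_vec (U k).
  by apply: eq_bigr => i _; rewrite mxE.
rewrite /ideal_gens /Cpow !uE.
congr [:: _; _; _; _].
- exact: (@ext_top_pf_tri R N m A (U k1) (U k2) (U k3)).
- exact: (@ext_top_pf_lin R N m A (U k1)).
- exact: (@ext_top_pf_lin R N m A (U k2)).
- exact: (@ext_top_pf_lin R N m A (U k3)).
Qed.

Lemma res_d0_nth (i : 'I_(1 + 3)) : res_d0 m A U i 0 = [:: T; a k1; a k2; a k3]`_i.
Proof.
rewrite mxE; case: (splitP i) => k ->; rewrite !mxE ?ord1 ?eqxx ?mulr1n //.
by elim/ord3_ind: k.
Qed.

Lemma ideal_I_span (c : R) : c \in ideal_I m <->
  exists y : 'rV_(1 + 3), c%:M = y *m res_d0 m A U.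
Proof.
rewrite /ideal_I ideal_gensE.
split=> [/ideal_spanP[y ->] | [y /matrixP/(_ 0 0)]].
  exists (\row_i y i); apply/matrixP => i j; rewrite !ord1 !mxE mulr1n.
  by apply: eq_bigr => k _; rewrite res_d0_nth mxE.
rewrite !mxE mulr1n => ->; apply/ideal_spanP; exists (y 0).
by apply: eq_bigr => k _; rewrite res_d0_nth.
Qed.

Lemma res_mx_complex i : res_mx i.+1 *m res_mx i = 0.
Proof.
case: i => [|[|i]] /=; last by rewrite mul0mx.
  exact: res_d1d0.
exact: res_d2d1.
Qed.

(** The complex is read from its left end, where it begins with a zero module,
    and [lin_gens_regular] has one element for each of the three positions. *)
Lemma res_mx_exact i (x : 'rV_(res_rank i.+1)) :
  x *m res_mx i = 0 -> exists y, x = y *m res_mx i.+1.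
Proof.
pose r i := match i with 0 => 0 | 1 => N | 2 => N + 3 | 3 => 1 + 3 | 4 => 1 | _ => 0 end%N.
pose M i : 'M[R]_(r i, r i.+1) := match i return 'M[R]_(r i, r i.+1) with
  | 1 => res_d2 A U | 2 => res_d1 m A U | 3 => res_d0 m A U | _ => 0 end.
pose s := [:: a k1; a k2; a k3].
have exM j : (j < 3)%N -> forall x : 'rV_(r j.+1), x *m M j.+1 = 0 -> exists y, x = y *m M j.
  move=> lt_j z zM; have [|||||w wP] := @complex_exact_mod R s r M _ erefl _ _ j 0 _ z _.
  - exact: lin_gens_regular.
  - case=> [|[|[|[|j']]]] /=; rewrite ?mul0mx ?mulmx0 //; first exact: res_d2d1.
    exact: res_d1d0.
  - move=> i' j' lt_ij; have [k ->] : exists k, s`_j' = a k.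
      by case: j' lt_ij => [|[|[|j']]]; [exists k1 | exists k2 | exists k3 | rewrite /s /=; lia].
    case: i' lt_ij => [|[|[|i']]] lt_ij /=.
    + by exists 0, (htpy2 m A U k); rewrite mul0mx add0r res_htpy3.
    + by exists (htpy2 m A U k), (htpy1 U k); rewrite addrC res_htpy2.
    + by exists (htpy1 U k), (htpy0 _ k); rewrite addrC res_htpy1.
    by move: lt_ij; rewrite /s /=; lia.
  - by rewrite addn0.
  - by move=> k; rewrite zM mxE ideal_span0.
  exists w; apply/matrixP => k l; rewrite ord1; apply/eqP; rewrite -subr_eq0.
  by have := wP l; rewrite take0 => /ideal_span_nil; rewrite !mxE => ->.
case: i x => [|[|[|i]]] x /= xD.
- exact: (exM 2%N).
- exact: (exM 1%N).
- by have [y xy] := exM 0%N isT x xD; exists 0; rewrite mul0mx xy /= mulmx0.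
by exists 0; apply/matrixP => k [].
Qed.

Lemma bihomog_cast (d e : int * int) (p : R) :
  bihomogeneous d p -> d.1 = e.1 -> d.2 = e.2 -> bihomogeneous e p.
Proof. by case: d e => [d1 d2] [e1 e2] hp /= <- <-. Qed.

Lemma res_mx_bihomog i (j : 'I_(res_rank i.+1)) (k : 'I_(res_rank i)) :
  bihomogeneous (res_deg j - res_deg k) (res_mx i j k).
Proof.
have hU := @bihomog_U m; have hg := @bihomog_delta m.
case: i j k => [|[|[|i]]] j k /=; last by case: j.
- rewrite mxE; case: (split j) => j'; rewrite !mxE.
    rewrite !ord1 eqxx mulr1n.
    by apply: bihomog_cast (bihomog_pf_tri (hU _) (hU _) (hU _)) _ _ => /=; lia.
  by apply: bihomog_cast (bihomog_pf_lin (hU _)) _ _ => /=; lia.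
- rewrite mxE; case: (split j) => j'; rewrite mxE; case: (split k) => k'; rewrite mxE.
  + rewrite -pf_lin_delta; by apply: bihomog_cast (bihomog_pf_lin (hg _)) _ _ => /=; lia.
  + apply: (@bihomog_cast (Posz (m - 1), 2)) => /=; [|lia|lia].
    have deg_tri l l' : bihomogeneous (Posz (m - 1), 2)
        (pf_tri m A (fun x => (x == j')%:R) (U l) (U l')).
      by apply: bihomog_cast (bihomog_pf_tri (hg _) (hU _) (hU _)) _ _ => /=; lia.
    by case: k' => -[|[|k']] ?; apply: deg_tri.
  + exact: bihomog0.
  apply: (@bihomog_cast (Posz m, 1)) => /=; [|lia|lia].
  have deg_lin l : bihomogeneous (Posz m, 1) (a l).
    by apply: bihomog_cast (bihomog_pf_lin (hU _)) _ _ => /=; lia.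
  by case: j' k' => -[|[|[|//]]] ? [[|[|[|//]]] ?] /=;
    first [exact: bihomog0 | exact/bihomogN/deg_lin | exact: deg_lin].
rewrite mxE; case: (split k) => k'.
  by apply: bihomog_cast (bihomog_skew _ _) _ _ => /=; lia.
by rewrite mxE; apply: bihomog_cast (bihomog_U _ _) _ _ => /=; lia.
Qed.

Lemma res_deg_neq i (j : 'I_(res_rank i.+1)) (k : 'I_(res_rank i)) :
  res_deg j - res_deg k != 0.
Proof.
case: i j k => [|[|[|i]]] j k /=; last by case: j.
- by case: (split j) => _; apply/eqP => -[]; lia.
- by case: (split j) => _; case: (split k) => _; apply/eqP => -[]; lia.
by case: (split k) => _; apply/eqP => -[]; lia.
Qed.

Lemma res_mx_const i j k : (res_mx i j k)@_0%MM = 0.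
Proof. exact: bihomog_const (res_mx_bihomog j k) (res_deg_neq j k). Qed.

Lemma map_res_mx i : map_mx eps (res_mx i) = 0.
Proof. by apply/matrixP => j k; rewrite !mxE; apply: res_mx_const. Qed.

Definition res_aug (v : 'rV[R]_1) : quot_module (ideal_I m) := quot_pi (ideal_I m) (v 0 0).

Fact res_aug_linear : linear res_aug.
Proof. by move=> c u v; rewrite /res_aug !mxE -linearP. Qed.
HB.instance Definition _ :=
  GRing.isLinear.Build R 'rV[R]_1 (quot_module (ideal_I m)) *:%R res_aug res_aug_linear.

Lemma res_is_resolution :
  @is_resolution R (quot_module (ideal_I m)) (fun i => 'rV[R]_(res_rank i))
    (fun i => mulmxr (res_mx i)) res_aug.
Proof.
split=> [y | x | i x].
- by have [v <-] := quot_pi_surj y; exists v%:M; rewrite /= /res_aug mxE eqxx mulr1n.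
- have -> : (res_aug x = 0) <-> (x 0 0 \in ideal_I m).
    rewrite /res_aug -(linear0 (quot_pi (ideal_I m))); split=> [/eqP|xI].
      by rewrite quot_pi_eq subr0.
    by apply/eqP; rewrite quot_pi_eq subr0.
  rewrite ideal_I_span -mx11_scalar; split=> -[y yx]; exists y; first by rewrite yx.
  by rewrite -yx.
split=> [/res_mx_exact[y ->] | [y <-]]; first by exists y.
by rewrite /= -mulmxA res_mx_complex mulmx0.
Qed.

Lemma ideal_I_const x : x \in ideal_I m -> eps x = 0.
Proof.
case/ideal_I_span => y /matrixP/(_ 0 0)/(congr1 eps); rewrite !mxE mulr1n => ->.
rewrite rmorph_sum big1 // => k _; rewrite rmorphM.
by rewrite [X in _ * X](res_mx_const (i := 0)) mulr0.
Qed.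

Lemma ideal_I_regular : regular_sequence [:: a k1; a k2; a k3] /\
  {subset [:: a k1; a k2; a k3] <= ideal_I m}.
Proof.
have sub_I : {subset [:: a k1; a k2; a k3] <= ideal_I m}.
  move=> x /(nthP 0)[i lt_i <-]; rewrite /ideal_I ideal_gensE.
  exact: (@ideal_span_nth _ [:: T; a k1; a k2; a k3] i.+1).
split=> //; split; last exact: lin_gens_regular.
apply/negP => one_in; have : (1 : R) \in ideal_I m.
  by apply: ideal_span_min one_in => i lt_i; apply/sub_I/mem_nth.
by move=> /ideal_I_const /eqP; rewrite rmorph1 oner_eq0.
Qed.

Lemma ideal_I_grade : has_grade (ideal_I m) 3.
Proof.
have [reg sub] := ideal_I_regular; split; first by exists [:: a k1; a k2; a k3].
apply: (@regular_sequence_size_le R res_rank res_mx res_mx_complex res_mx_exact _ _ eps 2) => //.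
- by move=> c /ideal_I_span[y yE]; exists y.
- exact: map_res_mx.
by rewrite /= addn1.
Qed.

Lemma projective_dimension_quot : has_projective_dimension (quot_module (ideal_I m)) 3.
Proof.
split.
  exists (fun i => 'rV[R]_(res_rank i)), (fun i => mulmxr (res_mx i)), res_aug.
  split; [exact: res_is_resolution | by move=> i; apply: projective_rV |].
  by case=> [|[|[|[|i]]]] // _ x; apply/matrixP => ? [].
move=> k; apply: (@resolution_length_ge _ _ _ _ _ _ eps 2 res_is_resolution) => //.
  exact: map_res_mx.
by rewrite /= addn1.
Qed.

Lemma ideal_I_minimally_generated : minimally_generated_by (ideal_I m) 4.
Proof.
split; first by exists (ideal_gens m).
move=> s; apply: (@generators_size_ge R int eps 4 (res_mx 0) _ s ideal_I_span).
move=> y /(res_mx_exact (i := 0))[z ->].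
by rewrite map_mxM map_res_mx mulmx0.
Qed.

Lemma ideal_I_has_type : has_type (ideal_I m) N.
Proof.
exists res_rank, res_deg, res_mx, res_aug; split=> //; split.
- exact: res_is_resolution.
- move=> k; exists 1; first exact: bihomog1.
  by rewrite /= /res_aug mxE !ord1 eqxx.
- exact: res_mx_bihomog.
exact: res_mx_const.
Qed.

End Resolution.

Theorem proposition3p3 (m n : nat) (hm : (1 <= m)%N) (hn : n = (2 * m + 4)%N) :
  grade3_almost_complete_intersection (ideal_I m) /\
  has_type (ideal_I m) (2 * m + 1)%N /\
  (2 * m + 1 = n - 3)%N.
Proof.
split; last by split; [exact: ideal_I_has_type | lia].
split; last exact: ideal_I_minimally_generated.
by split; [exact: ideal_I_grade | exact: projective_dimension_quot].
Qed.
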